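(* Let $d\geq 2$ be a squarefree integer. Then $\{f\in\mathbb{N}:{\rm h}(d)=|{\rm Pic}(\mathcal{O}_f)|\}=\{1\}$ if and only if ${\rm N}(\varepsilon)=1$, $d\not\equiv 1\mod 8$, $y$ is even and $d\mid y$.
   Context: Let $d\geq 2$ be a squarefree integer, $K=\mathbb{Q}(\sqrt{d})$, and $\mathcal{O}_K$ its ring of algebraic integers. Set $\omega=\sqrt{d}$ if $d\equiv 2,3\mod 4$ and $\omega=\frac{1+\sqrt{d}}{2}$ if $d\equiv 1\mod 4$; then $\mathcal{O}_K=\mathbb{Z}[\omega]$. Let $\varepsilon>1$ be the fundamental unit of $\mathcal{O}_K$ (i.e., the unit group of $\mathcal{O}_K$ is $\{\pm\varepsilon^k:k\in\mathbb{Z}\}$), and let $x,y$ be the unique nonnegative integers with $\varepsilon=x+y\omega$. Let ${\rm N}:K\to\mathbb{Q}$, ${\rm N}(a+b\sqrt{d})=a^2-db^2$ for $a,b\in\mathbb{Q}$, be the norm map. $\mathbb{N}$ denotes the set of positive integers. For $f\in\mathbb{N}$ let $\mathcal{O}_f=\mathbb{Z}+f\mathcal{O}_K$ be the order in $K$ with conductor $f$, let ${\rm Pic}(\mathcal{O}_f)$ be its Picard group, and let ${\rm h}(d)=|{\rm Pic}(\mathcal{O}_K)|$ be the class number of $K$. (When the displayed set equals $\{1\}$, $d$ is said to have no nontrivial conductors of relative class number one, or to satisfy (RC).) *)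

(* Defs.v *)
From HB Require Import structures.
From mathcomp Require Import all_boot all_order all_algebra all_field.
From mathcomp Require Import ring.
From mathcomp Require Import boolp classical_sets functions cardinality.

Set Implicit Arguments.
Unset Strict Implicit.
Unset Printing Implicit Defensive.

Import Order.TTheory GRing.Theory Num.Theory.

Local Open Scope classical_set_scope.
Local Open Scope ring_scope.

Definition squarefree (d : nat) : Prop :=
  forall m : nat, (m ^ 2 %| d)%N -> m = 1%N.

Definition in_quad (d : nat) : {pred algC} :=
  fun z => `[< exists a b : rat, z = ratr a + ratr b * sqrtC d%:R >].

Lemma in_quadP d z :
  reflect (exists a b : rat, z = ratr a + ratr b * sqrtC d%:R) (z \in in_quad d).
Proof. exact: asboolP. Qed.

Lemma in_quad_divring d : divring_closed (in_quad d).
Proof.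
set s : algC := sqrtC d%:R; have ss : s * s = ratr d%:R.
  by rewrite -expr2 sqrtCK rmorph_nat.
have mulq : {in in_quad d &, forall u v, u * v \in in_quad d}.
  move=> _ _ /in_quadP[a [b ->]] /in_quadP[a' [b' ->]]; apply/in_quadP.
  exists (a * a' + b * b' * d%:R), (a * b' + b * a').
  by rewrite -/s !(rmorphD, rmorphM) /= -ss; ring.
split=> [|u v|u v].
- by apply/in_quadP; exists 1, 0; rewrite rmorph1 rmorph0 mul0r addr0.
- move=> /in_quadP[a [b ->]] /in_quadP[a' [b' ->]]; apply/in_quadP.
  exists (a - a'), (b - b').
  by rewrite !rmorphB /= mulrBl opprD addrACA.
move=> Ku Kv; apply: mulq => //; move/in_quadP: Kv => [a [b ->]].
rewrite -/s; set n := a ^+ 2 - d%:R * b ^+ 2.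
have En : ratr n = (ratr a - ratr b * s) * (ratr a + ratr b * s) :> algC.
  by rewrite /n !expr2 rmorphB !rmorphM /= -ss; ring.
have [n0|nN0] := eqVneq n 0.
  move/esym/eqP: En; rewrite n0 rmorph0 mulf_eq0 => /orP[|/eqP ->]; last first.
    by apply/in_quadP; exists 0, 0; rewrite invr0 rmorph0 mul0r addr0.
  rewrite subr_eq0 => /eqP <-; apply/in_quadP; exists (a + a)^-1, 0.
  by rewrite rmorph0 mul0r addr0 fmorphV rmorphD.
apply/in_quadP; exists (a / n), (- b / n).
have nC0 : ratr n != 0 :> algC by rewrite fmorph_eq0.
have z0 : ratr a + ratr b * s != 0.
  by apply: contraNneq nC0 => z0; rewrite En z0 mulr0.
apply: (mulIf z0); rewrite mulVf // !fmorph_div /= rmorphN /=.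
rewrite -[LHS](divff nC0) {1}En.
by rewrite -/s; field.
Qed.

HB.instance Definition _ d :=
  GRing.isDivringClosed.Build algC (in_quad d) (in_quad_divring d).

Record quad (d : nat) : predArgType :=
  Quad { quad_val :> algC; quad_valP : quad_val \in in_quad d }.

HB.instance Definition _ d := [isSub for @quad_val d].
HB.instance Definition _ d := [Choice of quad d by <:].
HB.instance Definition _ d := [SubChoice_isSubComUnitRing of quad d by <:].
HB.instance Definition _ d := [SubComUnitRing_isSubIntegralDomain of quad d by <:].
HB.instance Definition _ d := [SubIntegralDomain_isSubField of quad d by <:].

Lemma sqrtd_subproof d : sqrtC d%:R \in in_quad d.
Proof. by apply/in_quadP; exists 0, 1; rewrite rmorph0 rmorph1 mul1r add0r. Qed.

Definition sqrtd d : quad d := Quad (sqrtd_subproof d).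

Definition omega d : quad d :=
  if (d %% 4 == 1)%N then (1 + sqrtd d) / 2%:R else sqrtd d.

(* The coordinates [a] and [b] are unique when [d] is not a square; see
   [quad_normE]. *)
Definition quad_norm d (z : quad d) : rat :=
  xget 0 [set n | exists a b : rat,
    z = ratr a + ratr b * sqrtd d /\ n = a ^+ 2 - d%:R * b ^+ 2].

Definition ringint d : set (quad d) := [set z | quad_val z \in Aint].

Definition order_cond d (f : nat) : set (quad d) :=
  [set z | exists m : int, exists2 w, ringint w & z = m%:~R + f%:R * w].

Definition unit_of (F : fieldType) (A : set F) : set F :=
  [set u | [/\ u != 0, A u & A u^-1]].

(* The comparison takes place in [algC], where [1 < eps] means that [eps] is
   real and greater than 1; [sqrtC d%:R] is the nonnegative square root. *)
Definition fundamental_unit d (eps : quad d) : Prop :=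
  1 < quad_val eps /\
  unit_of (@ringint d) =
    [set u | exists k : int, u = eps ^ k \/ u = - eps ^ k].

Section Picard.
Variables (F : fieldType) (A : set F).

Definition fractional_ideal : set (set F) :=
  [set I | [/\ exists2 x, I x & x != 0,
               forall x y, I x -> I y -> I (x + y),
               forall a x, A a -> I x -> I (a * x) &
               exists c, [/\ A c, c != 0 & forall x, I x -> A (c * x)]]].

Definition ideal_mul (I J : set F) : set F :=
  [set z | exists s : seq (F * F),
    (forall p, p \in s -> I p.1 /\ J p.2) /\ z = \sum_(p <- s) p.1 * p.2].

Definition invertible_ideal : set (set F) :=
  [set I | fractional_ideal I /\
           exists2 J, fractional_ideal J & ideal_mul I J = A].

Definition principal_ideal : set (set F) :=
  [set [set c * a | a in A] | c in [set c | c != 0]].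

(* For a domain [A] with field of fractions [F]: the underlying set of the
   quotient of the group of invertible fractional ideals by its subgroup of
   principal ones, that is, the set of all cosets. *)
Definition Pic : set (set (set F)) :=
  [set [set ideal_mul I P | P in principal_ideal] | I in invertible_ideal].

End Picard.

Lemma sqrtd_irrational d (q : rat) :
  (2 <= d)%N -> squarefree d -> ratr q != sqrtC d%:R :> algC.
Proof.
move=> d2 sfd; apply/eqP => Eq.
have sI : (sqrtC d%:R : algC) \in Num.int.
  apply: Cint_rat_Aint; first by rewrite -Eq Crat_rat.
  apply: (@root_monic_Aint ('X^2 - (d%:R)%:P)).
  - by rewrite rootE !hornerE sqrtCK subrr.
  - exact: monicXnsubC.
  - apply/polyOverP => i; rewrite coefB coefXn coefC.
    by case: (i == 2)%N; case: (i == 0)%N; rewrite ?rpredB ?rpred0 ?rpred1 ?rpred_nat.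
have /natrP[m Em] : (sqrtC d%:R : algC) \in Num.nat.
  by rewrite natrEint sI sqrtC_ge0 ler0n.
have /eqP : (d%:R : algC) = (m ^ 2)%:R by rewrite natrX -Em sqrtCK.
rewrite eqr_nat => /eqP Ed.
by move: d2; rewrite Ed (sfd m) // Ed.
Qed.

Lemma quad_val_ratr d (a b : rat) :
  quad_val (ratr a + ratr b * sqrtd d) = ratr a + ratr b * sqrtC d%:R.
Proof.
have valq q : \val (ratr q : quad d) = ratr q by exact: fmorph_rat.
by rewrite -!valq.
Qed.

Lemma quad_normE d (a b : rat) : (2 <= d)%N -> squarefree d ->
  quad_norm (ratr a + ratr b * sqrtd d) = a ^+ 2 - d%:R * b ^+ 2.
Proof.
move=> d2 sfd; rewrite /quad_norm; case: xgetP => [n _|]; last first.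
  by move/(_ (a ^+ 2 - d%:R * b ^+ 2)); case; exists a, b.
case=> a' [b' [/(congr1 (@quad_val d)) + ->]].
rewrite !quad_val_ratr => Eab.
have [Eb|Nb] := eqVneq b b'.
  move: Eab; rewrite Eb => /addIr /fmorph_inj -> //.
have bb : ratr (b - b') != 0 :> algC by rewrite fmorph_eq0 subr_eq0.
case/eqP: (sqrtd_irrational ((a' - a) / (b - b')) d2 sfd).
rewrite fmorph_div /=; apply: (mulIf bb); rewrite divfK // !rmorphB /=.
rewrite mulrBr ![sqrtC _ * _]mulrC; apply/eqP.
by rewrite subr_eq addrAC eq_sym subr_eq addrC Eab addrC.
Qed.

(* Main.v *)
(* For an order A = O_f in the maximal order B, extension of ideals I |-> I B
   maps Pic A onto Pic B, and it is injective iff every residue of B that is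
   invertible modulo f becomes a residue of A after multiplication by a unit of
   B.  Since Pic B is finite, this residue criterion is equivalent to
   |Pic A| = |Pic B|, and it passes from f to the prime divisors p of f.  So only
   primes matter.  If p is odd, prime to d and N(eps) = 1, units have norm 1, hence
   residues whose norm is not a square modulo p violate the criterion.  If p = 2
   is not split or p | d, the criterion fails when p | y, as all units are then
   integers modulo p.  Conversely it holds for f = 3 if N(eps) = -1, for f = 2 if
   d = 1 mod 8 or y is odd, and for odd p | d with p not dividing y. *)
Require Import Defs.
From mathcomp Require Import all_boot all_order all_algebra all_field.
From mathcomp Require Import ring lra zify.
From mathcomp Require Import finmap.
From mathcomp Require Import boolp classical_sets functions cardinality.

Set Implicit Arguments.
Unset Strict Implicit.
Unset Printing Implicit Defensive.

Import Order.TTheory GRing.Theory Num.Theory.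

Local Open Scope classical_set_scope.
Local Open Scope card_scope.
Local Open Scope ring_scope.

(** * Ideal classes of a ring and of an overring *)

(** The ideal theory is done for an arbitrary ring [A] inside [B] with [cB] contained in [A].
    Maximal ideals and localisation are avoided: what the finiteness of [B/cB] supplies is an
    idempotent power, modulo [cB], of every element. This makes an invertible module generated by
    one element modulo [cB], which yields both the surjectivity of the map on Picard groups and the
    description of its kernel. The norm is an obstruction because an element of [O_p] is an integer
    modulo [p], so its norm is a square there. The positive cases hold because modulo [p], and up to
    factors from [F_p], the powers of [eps] exhaust the invertible residues. *)

Lemma card_image_inj (T U : choiceType) (f : T -> U) (X : set T) :
  finite_set X -> f @` X #= X -> {in X &, injective f}.
Proof.
move=> finX /fcard_eq; rewrite fset_set_image // => /(_ (finite_image f finX) finX).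
move/eqP/card_in_imfsetP => inj x y Xx Xy; apply: inj => //=.
  by rewrite in_fset_set.
by rewrite in_fset_set.
Qed.

Section Ideals.
Variable F : fieldType.
Implicit Types (A B I J L P : set F) (a b c x y z u v w : F).

Definition subring A : Prop :=
  [/\ A 1, forall x y, A x -> A y -> A (x - y)
    & forall x y, A x -> A y -> A (x * y)].

(** Weaker than [fractional_ideal]: neither a nonzero element nor a common denominator is required,
    since invertibility provides both ([invertible_idealE]). *)
Definition submod A I : Prop :=
  [/\ I 0, forall x y, I x -> I y -> I (x + y)
    & forall a x, A a -> I x -> I (a * x)].

Lemma subring0 A : subring A -> A 0.
Proof. by case=> A1 AB _; rewrite -(subrr 1); apply: AB. Qed.

Lemma subringN A x : subring A -> A x -> A (- x).
Proof. by move=> sA Ax; rewrite -sub0r; case: (sA) => _ + _; apply=> //; apply: subring0. Qed.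

Lemma subringB A x y : subring A -> A x -> A y -> A (x - y).
Proof. by case=> _ + _; apply. Qed.

Lemma subringD A x y : subring A -> A x -> A y -> A (x + y).
Proof. by move=> sA Ax Ay; rewrite -[y]opprK; apply: subringB => //; apply: subringN. Qed.

Lemma subringM A x y : subring A -> A x -> A y -> A (x * y).
Proof. by case=> _ _; apply. Qed.

Lemma subring1 A : subring A -> A 1. Proof. by case. Qed.

Lemma subringX A x n : subring A -> A x -> A (x ^+ n).
Proof.
move=> sA Ax; elim: n => [|n IHn]; first by rewrite expr0; apply: subring1.
by rewrite exprS; apply: subringM.
Qed.

Lemma subring_sum A n (G : 'I_n -> F) :
  subring A -> (forall i, A (G i)) -> A (\sum_i G i).
Proof.
move=> sA AG; apply: (big_ind A) => //; first exact: subring0.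
by move=> x y Ax Ay; apply: subringD.
Qed.

Lemma subring_submod A : subring A -> submod A A.
Proof.
move=> sA; split; first exact: subring0.
- by move=> x y; apply: subringD.
- by move=> a x; apply: subringM.
Qed.

Lemma submod0 A I : submod A I -> I 0. Proof. by case. Qed.

Lemma submodD A I x y : submod A I -> I x -> I y -> I (x + y).
Proof. by case=> _ + _; apply. Qed.

Lemma submodM A I a x : submod A I -> A a -> I x -> I (a * x).
Proof. by case=> _ _; apply. Qed.

Lemma submodN A I x : subring A -> submod A I -> I x -> I (- x).
Proof.
move=> sA sI Ix; rewrite -mulN1r; apply: (submodM sI) => //.
by apply: subringN => //; apply: subring1.
Qed.

Lemma submodB A I x y : subring A -> submod A I -> I x -> I y -> I (x - y).
Proof. by move=> sA sI Ix Iy; apply: (submodD sI) => //; apply: submodN sI Iy. Qed.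

Lemma submod_sub A B I : A `<=` B -> submod B I -> submod A I.
Proof. by move=> AB [I0 ID IM]; split=> // a x /AB; apply: IM. Qed.

Lemma fractional_submod A I : subring A -> fractional_ideal A I -> submod A I.
Proof.
move=> sA [[x Ix _] ID IM _]; split=> //.
by rewrite -(mul0r x); apply: IM => //; apply: subring0.
Qed.

Lemma imul_in I J x y : I x -> J y -> ideal_mul I J (x * y).
Proof.
move=> Ix Jy; exists [:: (x, y)]; rewrite big_seq1; split=> // p.
by rewrite inE => /eqP ->.
Qed.

Lemma imul_ind I J L : L 0 -> (forall x y, L x -> L y -> L (x + y)) ->
  (forall x y, I x -> J y -> L (x * y)) -> ideal_mul I J `<=` L.
Proof.
move=> L0 LD LM _ [s [IJs ->]]; elim: s IJs => [|p s IHs] IJs.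
  by rewrite big_nil.
rewrite big_cons; apply: LD.
  by have [Ip Jp] := IJs p (mem_head _ _); apply: LM.
by apply: IHs => q qs; apply: IJs; rewrite inE qs orbT.
Qed.

Lemma imul0 I J : ideal_mul I J 0.
Proof. by exists [::]; rewrite big_nil; split. Qed.

Lemma imulD I J x y : ideal_mul I J x -> ideal_mul I J y -> ideal_mul I J (x + y).
Proof.
move=> [s [IJs ->]] [s' [IJs' ->]]; exists (s ++ s'); rewrite big_cat; split=> // p.
by rewrite mem_cat => /orP[/IJs|/IJs'].
Qed.

Lemma submod_imul A I J : submod A I -> submod A (ideal_mul I J).
Proof.
move=> sI; split; [exact: imul0|by move=> x y; apply: imulD|].
move=> a + Aa; pose L := [set x | ideal_mul I J (a * x)].
apply: (@imul_ind I J L); rewrite /L /=.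
- by rewrite mulr0; apply: imul0.
- by move=> x y Lx Ly; rewrite mulrDr; apply: imulD.
- by move=> x y Ix Jy; rewrite mulrA; apply: imul_in => //; apply: (submodM sI).
Qed.

Lemma imul_sub A I J L : submod A L ->
  (forall x y, I x -> J y -> L (x * y)) -> ideal_mul I J `<=` L.
Proof. by move=> [L0 LD _]; apply: imul_ind. Qed.

Lemma imulC I J : ideal_mul I J = ideal_mul J I.
Proof.
by apply/seteqP; split; apply: imul_ind; [exact: imul0|exact: imulD| |
  exact: imul0|exact: imulD|] => x y Ix Jy; rewrite mulrC; apply: imul_in.
Qed.

Lemma imulA I J L : ideal_mul I (ideal_mul J L) = ideal_mul (ideal_mul I J) L.
Proof.
suff sub I' J' L' :
    ideal_mul I' (ideal_mul J' L') `<=` ideal_mul (ideal_mul I' J') L'.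
  apply/seteqP; split; first exact: sub.
  by rewrite imulC [ideal_mul I J]imulC [ideal_mul I _]imulC
             [ideal_mul J L]imulC; apply: sub.
apply: imul_ind; [exact: imul0|exact: imulD|] => x + I'x.
pose M := [set z | ideal_mul (ideal_mul I' J') L' (x * z)].
apply: (@imul_ind _ _ M); rewrite /M /=.
- by rewrite mulr0; apply: imul0.
- by move=> y z My Mz; rewrite mulrDr; apply: imulD.
- by move=> y z J'y L'z; rewrite mulrA; apply: imul_in => //; apply: imul_in.
Qed.

Lemma imulACA I J L P :
  ideal_mul (ideal_mul I J) (ideal_mul L P) = ideal_mul (ideal_mul I L) (ideal_mul J P).
Proof. by rewrite -!imulA; congr ideal_mul; rewrite !imulA [ideal_mul J L]imulC. Qed.

Lemma imul_id A I : subring A -> submod A I -> ideal_mul I A = I.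
Proof.
move=> sA sI; apply/seteqP; split.
  by apply: (imul_sub sI) => x a Ix Aa; rewrite mulrC; apply: (submodM sI).
by move=> x Ix; rewrite -[x]mulr1; apply: imul_in => //; apply: subring1.
Qed.

Lemma imul_over A B : subring A -> subring B -> A `<=` B -> ideal_mul A B = B.
Proof.
move=> sA sB AB; rewrite imulC; apply: imul_id => //.
exact/(submod_sub AB)/subring_submod.
Qed.

Definition scale c I : set F := [set c * x | x in I].

Lemma scaleP c I x : c != 0 -> scale c I x <-> I (c^-1 * x).
Proof.
move=> c0; split=> [[y Iy <-]|Ix]; first by rewrite mulKf.
by exists (c^-1 * x) => //; rewrite mulVKf.
Qed.

Lemma scale_scale c c' I : scale c (scale c' I) = scale (c * c') I.
Proof. by rewrite /scale image_comp; congr image; apply/funext => x /=; rewrite mulrA. Qed.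

Lemma scale1 I : scale 1 I = I.
Proof. by rewrite /scale -[RHS]image_id; congr image; apply/funext => x; rewrite mul1r. Qed.

Lemma submod_scale A c I : submod A I -> submod A (scale c I).
Proof.
move=> sI; split; first by exists 0; [exact: (submod0 sI)|rewrite mulr0].
- move=> _ _ [u Iu <-] [v Iv <-].
  by exists (u + v); [exact: (submodD sI)|rewrite mulrDr].
- by move=> a _ Aa [u Iu <-]; exists (a * u); [exact: (submodM sI)|rewrite mulrCA].
Qed.

Lemma imul_scale c I J : ideal_mul I (scale c J) = scale c (ideal_mul I J).
Proof.
apply/seteqP; split; last first.
  move=> _ [x IJx <-]; move: x IJx.
  pose M := [set z | ideal_mul I (scale c J) (c * z)].
  apply: (@imul_ind _ _ M); rewrite /M /=.
  - by rewrite mulr0; apply: imul0.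
  - by move=> y z My Mz; rewrite mulrDr; apply: imulD.
  - by move=> y z Iy Jz; rewrite mulrCA; apply: imul_in => //; exists z.
apply: imul_ind.
- by exists 0; rewrite ?mulr0 //; apply: imul0.
- move=> _ _ [x IJx <-] [y IJy <-]; exists (x + y); rewrite ?mulrDr //.
  exact: imulD.
- by move=> x _ Ix [y Jy <-]; exists (x * y); [exact: imul_in|rewrite mulrCA].
Qed.

Lemma imul_scalel c I J : ideal_mul (scale c I) J = scale c (ideal_mul I J).
Proof. by rewrite imulC imul_scale imulC. Qed.

Definition ideal_class A I : set (set F) :=
  [set ideal_mul I P | P in principal_ideal A].

Lemma ideal_classE A I : subring A -> submod A I ->
  ideal_class A I = [set scale c I | c in [set c | c != 0]].
Proof.
move=> sA sI; rewrite /ideal_class /principal_ideal image_comp.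
apply/seteqP; split=> _ [c c0 <-]; exists c => //=;
  by rewrite -/(scale c A) imul_scale imul_id.
Qed.

Lemma eq_ideal_class A I J : subring A -> submod A I -> submod A J ->
  ideal_class A I = ideal_class A J <-> exists2 c, c != 0 & J = scale c I.
Proof.
move=> sA sI sJ; rewrite !ideal_classE //; split=> [E|[c c0 ->]].
  have [c c0 Ec] : [set scale c I | c in [set c | c != 0]] J.
    by rewrite E; exists 1; [exact: oner_neq0|exact: scale1].
  by exists c.
apply/seteqP; split=> _ [e e0 <-].
  exists (e / c); first by rewrite /= mulf_neq0 // invr_eq0.
  by rewrite scale_scale divfK.
by exists (e * c); [exact: mulf_neq0|rewrite scale_scale].
Qed.

Definition fraction_ring A : Prop :=
  forall z, exists a, [/\ A a, a != 0 & A (a * z)].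

Definition has_inverse A I : Prop :=
  submod A I /\ exists2 J, submod A J & ideal_mul I J = A.

Lemma imul_neq0 I J : ideal_mul I J 1 -> exists2 x, J x & x != 0.
Proof.
move=> IJ1; apply: contrapT => nJ; case/eqP: (oner_neq0 F); move: IJ1.
apply: (@imul_ind I J [set x | x = 0]) => // [x y /= -> ->|x y _ Jy /=].
  by rewrite addr0.
have [->|y0] := eqVneq y 0; first by rewrite mulr0.
by case: nJ; exists y.
Qed.

(** If [IJ = A], then [1] in [IJ] forces nonzero elements in [I] and [J]; for a nonzero [y] in [J]
    one has [yI] inside [A], so clearing the denominator of [y] gives a common denominator of
    [I]. *)
Lemma invertible_idealE A I : subring A -> fraction_ring A ->
  invertible_ideal A I <-> has_inverse A I.
Proof.
move=> sA fA; split=> [[fI [J fJ IJ]]|[sI [J sJ IJ]]].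
  by split; [exact: fractional_submod|exists J => //; exact: fractional_submod].
have fracl I' J' : submod A I' -> submod A J' -> ideal_mul I' J' = A ->
    fractional_ideal A I'.
  move=> sI' sJ' IJ'; split; try by case: sI'.
    by apply: (@imul_neq0 J' I'); rewrite imulC IJ'; apply: subring1.
  have [|y J'y y0] := @imul_neq0 I' J'; first by rewrite IJ'; apply: subring1.
  have [a [Aa a0 Aay]] := fA y; exists (a * y); rewrite mulf_neq0 //; split=> // x Ix.
  by rewrite -mulrA; apply: subringM => //; rewrite -IJ' mulrC; apply: imul_in.
split; first exact: (fracl I J).
by exists J => //; apply: (fracl J I) => //; rewrite imulC.
Qed.

Lemma PicE A : subring A -> fraction_ring A ->
  Pic A = ideal_class A @` has_inverse A.
Proof.
move=> sA fA; rewrite /Pic -/(ideal_class A); congr image.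
by apply/seteqP; split=> I /invertible_idealE; apply.
Qed.

(* In a ring where every element has an idempotent power, invertible modules
   are free: induct on the number of generators, splitting off at each step
   the idempotent [e] on which the first term [x = a1 * b1] is a unit. *)
Lemma local_generator A I J m : subring A -> submod A I -> submod A J ->
    submod A m -> m `<=` A ->
    (forall x, A x -> exists2 n, (0 < n)%N & m (x ^+ (n + n) - x ^+ n)) ->
    ideal_mul I J = A ->
  exists a b, [/\ I a, J b & m (a * b - 1)].
Proof.
move=> sA sI sJ sm mA preg IJ.
have AIJ x y : I x -> J y -> A (x * y) by rewrite -IJ; apply: imul_in.
(* The target [1] becomes an element [r] idempotent modulo [m], so that the induction can continue
   on a smaller idempotent. *)
suff gen (s : seq (F * F)) r : (forall p, p \in s -> I p.1 /\ J p.2) -> A r ->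
    m (r * r - r) -> m (\sum_(p <- s) p.1 * p.2 - r) ->
    exists a b, [/\ I a, J b & m (a * b - r)].
  have [s [IJs E]] : ideal_mul I J 1 by rewrite IJ; apply: subring1.
  apply: (gen s 1) => //; first exact: subring1.
    by rewrite mulr1 subrr; apply: (submod0 sm).
  by rewrite -E subrr; apply: (submod0 sm).
have [k] := ubnP (size s); elim: k s r => // k IHk [|[a1 b1] s] r ltsk IJs Ar rr.
  rewrite big_nil sub0r => mr; exists 0, 0.
  by rewrite mulr0 sub0r; split=> //; [exact: (submod0 sI)|exact: (submod0 sJ)].
rewrite big_cons /=; set S := \sum_(p <- s) _ => mS.
have [Ia1 Jb1] := IJs _ (mem_head _ _); rewrite /= in Ia1 Jb1.
have IJs' p : p \in s -> I p.1 /\ J p.2.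
  by move=> ps; apply: IJs; rewrite inE ps orbT.
pose x := a1 * b1; have Ax : A x by apply: AIJ.
have [[//|n] _] := preg x Ax.
rewrite exprD; set X := x ^+ n.+1; set z := x ^+ n => mX.
have Az : A z by apply: subringX.
have XE : X = z * (a1 * b1) by rewrite /X exprSr.
have AX : A X by apply: subringX.
clearbody X.
(* [X] is idempotent modulo [m]. Since [(1 - x) G = 1 - X], the geometric sum [G] inverts [1 - x]
   where [X] vanishes. *)
pose G := \sum_(i < n.+1) x ^+ i.
have AG : A G by apply: subring_sum => // i; apply: subringX.
have GE : (1 - x) * G = 1 - X.
  by rewrite XE /z -/x -exprSr -[LHS]opprK -mulNr opprB -subrX1 opprB.
clearbody G z; pose r' := r - X * r.
have mlin u v w p q t : A u -> A v -> A w -> m p -> m q -> m t ->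
    m (u * p + v * q + w * t).
  move=> Au Av Aw mp mq mt; apply: (submodD sm); first apply: (submodD sm);
  exact: (submodM sm).
have A1 := subring1 sA; have A0 := subring0 sA.
have [a' [b' [Ia' Jb' mab']]] : exists a b, [/\ I a, J b & m (a * b - r')].
  (* On the part cut out by [r'], the tail [S] is congruent to [1 - x]; multiplying its terms by
     [r' G] makes it sum to [r']. *)
  apply: (IHk [seq (r' * G * p.1, p.2) | p <- s] r'); first by rewrite size_map.
  - move=> _ /mapP[p /IJs'[Ip Jp] ->] /=; split=> //.
    by apply: (submodM sI) => //; apply: subringM => //; apply: subringB => //; apply: subringM.
  - by apply: subringB => //; apply: subringM.
  - have -> : r' * r' - r' =
        (1 - X) ^+ 2 * (r * r - r) + r * (X * X - X) + 0 * (X * X - X).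
      by rewrite /r'; ring.
    by apply: mlin => //; apply: subringX => //; apply: subringB.
  - rewrite big_map /=; have -> : \sum_(p <- s) r' * G * p.1 * p.2 = r' * G * S.
      by rewrite mulr_sumr; apply: eq_bigr => p _; rewrite mulrA.
    have -> : r' * G * S - r' =
        r' * G * (x + S - r) + (1 - X) * G * (r * r - r) + r * (X * X - X).
      have -> : r' * G * S - r' = r' * G * (x + S - r) + r' * G * (r - 1)
          + r' * ((1 - x) * G) - r' by ring.
      by rewrite GE /r'; ring.
    have Ar' : A r' by apply: subringB => //; apply: subringM.
    by apply: mlin => //; apply: subringM => //; apply: subringB.
have Ar' : A r' by apply: subringB => //; apply: subringM.
have AXr : A (X * r) by apply: subringM.
(* The generators on the parts [X r] and [r'] are added; the cross terms vanish modulo [m] because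
   they carry [X (1 - X)]. *)
exists (X * r * z * a1 + r' * a'), (X * r * b1 + r' * b'); split.
- apply: (submodD sI); apply: (submodM sI) => //; exact: subringM.
- by apply: (submodD sJ); apply: (submodM sJ).
have -> : (X * r * z * a1 + r' * a') * (X * r * b1 + r' * b') - r =
    (X * X * X + (r' + 1) * (1 - X) ^+ 2) * (r * r - r)
    + (r * (X + 1) + (r' + 1) * r - r * r * (z * (a1 * b') + a' * b1)) * (X * X - X)
    + r' * r' * (a' * b' - r').
  have -> : (X * r * z * a1 + r' * a') * (X * r * b1 + r' * b') - r =
    X * X * r * r * (z * (a1 * b1))
    + X * r * r' * (z * (a1 * b') + a' * b1) + r' * r' * (a' * b') - r by ring.
  by rewrite -XE /r'; ring.
apply: mlin => //; last exact: subringM.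
  apply: subringD => //; first by do 2 apply: subringM => //.
  apply: subringM => //; first exact: subringD.
  by apply: subringX => //; apply: subringB.
apply: subringB => //; last first.
  apply: subringM => //; first exact: subringM.
  by apply: subringD => //; [apply: subringM => //|]; apply: AIJ.
by apply: subringD => //; apply: subringM => //; apply: subringD.
Qed.

(** * Extension of ideals to an overring *)

Section Extension.
Variables (A B : set F) (c : F).
Hypotheses (sA : subring A) (sB : subring B) (AB : A `<=` B).
Hypotheses (Ac : A c) (cBA : scale c B `<=` A).
Hypothesis preg : forall x, B x ->
  exists2 n, (0 < n)%N & scale c B (x ^+ (n + n) - x ^+ n).
Hypotheses (fA : fraction_ring A).

Let m := scale c B.

Let fB : fraction_ring B.
Proof. by move=> z; have [a [/AB Ba a0 /AB Baz]] := fA z; exists a. Qed.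

Let smB : submod B m.
Proof. exact/submod_scale/subring_submod. Qed.

Let smA : submod A m. Proof. exact: submod_sub AB smB. Qed.

Let Bc : B c. Proof. exact: AB. Qed.

Lemma submod_extend I : submod B (ideal_mul I B).
Proof. by rewrite imulC; apply/submod_imul/subring_submod. Qed.

Lemma has_inverse_extend I : has_inverse A I -> has_inverse B (ideal_mul I B).
Proof.
case=> sI [J sJ IJ]; split; first exact: submod_extend.
exists (ideal_mul J B); first exact: submod_extend.
rewrite imulA -(imulA I) (imulC B) imulA IJ (imul_over sA) //.
by rewrite imul_id //; apply: subring_submod.
Qed.

(** An invertible idempotent is [1], so modulo [cB] some power [s ^+ n.+1] is [1]. The inverse of
    [s] is then [s ^+ n], which stays in [A]. *)
Lemma regular_inverse s t : A s -> B t -> m (s * t - 1) ->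
  exists2 s', A s' & m (s * s' - 1).
Proof.
move=> As Bt mst; have Bs := AB As.
have [[//|n] _] := preg Bs; rewrite exprD exprS => mn.
exists (s ^+ n); first exact: subringX.
have mlt k : m ((s * t) ^+ k - 1).
  rewrite subrX1 mulrC; apply: (submodM smB) => //.
  by apply: (subring_sum sB) => i; apply: subringX => //; apply: subringM.
have -> : s * s ^+ n - 1 = t ^+ n.+1 * (s * s ^+ n * (s * s ^+ n) - s * s ^+ n)
    - (s * s ^+ n - 1) * ((s * t) ^+ n.+1 - 1).
  by rewrite exprMn !exprS; ring.
apply: (submodB sB smB); apply: (submodM smB) => //; first exact: subringX.
by apply: subringB; [|apply: subringM|apply: subring1] => //; apply: subringX.
Qed.

(* For [ab = 1 mod cB] with [a] in [J] and [b] in [J^-1], the [A]-module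
   [aA + cJ] is a model of [J] over [A], with inverse [bA + cJ^-1]. *)
Let model a J := [set z | exists u v, [/\ A u, J v & z = a * u + c * v]].

Let submod_model a J : submod B J -> submod A (model a J).
Proof.
move=> sJ; split.
- exists 0, 0; rewrite !mulr0 addr0; split=> //; [exact: subring0|exact: (submod0 sJ)].
- move=> _ _ [u [v [Au Jv ->]]] [u' [v' [Au' Jv' ->]]].
  exists (u + u'), (v + v'); split; [exact: subringD|exact: (submodD sJ)|ring].
- move=> e _ Ae [u [v [Au Jv ->]]]; exists (e * u), (e * v).
  by split; [exact: subringM|apply: (submodM sJ) => //; exact: AB|ring].
Qed.

(** Everything comes from [a * b = 1 + c * w]: products of the two models lie in [A] up to terms of
    [cB], and [1] and the elements of [J] are recovered by correcting [a * b] and [z * (a * b)]. *)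
Lemma model_spec J J' a b : submod B J -> submod B J' -> ideal_mul J J' = B ->
    J a -> J' b -> m (a * b - 1) ->
  has_inverse A (model a J) /\ ideal_mul (model a J) B = J.
Proof.
move=> sJ sJ' JJ' Ja Jb mab.
have BJJ x y : J x -> J' y -> B (x * y) by rewrite -JJ'; apply: imul_in.
have [w Bw Ew] := mab; have Eab : a * b = 1 + c * w by rewrite Ew; ring.
have smd := submod_model; have A0 := subring0 sA; have A1 := subring1 sA.
have Ia J1 a1 : submod B J1 -> model a1 J1 a1.
  by move=> sJ1; exists 1, 0; rewrite mulr1 mulr0 addr0; split=> //; apply: (submod0 sJ1).
have Ic J1 a1 z : J1 z -> model a1 J1 (c * z).
  by move=> J1z; exists 0, z; rewrite mulr0 add0r.
split.
  split; first exact: smd.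
  exists (model b J'); first exact: smd.
  have sII := submod_imul (model b J') (smd a J sJ).
  apply/seteqP; split.
    apply: (imul_sub (subring_submod sA)).
    move=> _ _ [u [v [Au Jv ->]]] [u' [v' [Au' Jv' ->]]].
    have -> : (a * u + c * v) * (b * u' + c * v') =
       u * u' + c * (u * u' * w + u * (a * v') + u' * (v * b) + c * (v * v')).
      by rewrite mulrDl !mulrDr [a * u * _]mulrACA Eab; ring.
    apply: subringD => //; first exact: subringM.
    apply: cBA; eexists; last reflexivity.
    have Bu := AB Au; have Bu' := AB Au'.
    have Bav : B (a * v') by apply: BJJ.
    have Bvb : B (v * b) by apply: BJJ.
    have Bvv : B (v * v') by apply: BJJ.
    by do ?[assumption|apply: (subringD sB)|apply: (subringM sB)].
  suff II1 : ideal_mul (model a J) (model b J') 1.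
    by move=> x Ax; rewrite -[x]mulr1; apply: (submodM sII).
  have -> : 1 = a * b - c * w by rewrite Eab addrK.
  apply: (submodB sA sII); first by apply: imul_in; apply: Ia.
  have sII0 := submod0 sII.
  (* The terms [cJ] and [cJ'] multiply to [c^2 B], which absorbs the second-order error left
     below. *)
  have IIcc z : B z -> ideal_mul (model a J) (model b J') (c * c * z).
    rewrite -JJ'; pose L := [set z | ideal_mul (model a J) (model b J') (c * c * z)].
    apply: (@imul_ind J J' L); rewrite /L /=; first by rewrite mulr0.
      by move=> x y Lx Ly; rewrite mulrDr; apply: (submodD sII).
    by move=> x y Jx J'y; rewrite mulrACA; apply: imul_in; apply: Ic.
  have -> : c * w = a * (c * (w * b)) - c * c * (w * w).
    transitivity (c * w * (a * b) - c * c * (w * w)); last by ring.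
    by rewrite Eab; ring.
  apply: (submodB sA sII); last by apply: IIcc; apply: subringM.
  by apply: imul_in; [apply: Ia|apply/Ic/(submodM sJ')].
apply/seteqP; split.
  apply: (imul_sub sJ) => _ y [u [v [Au Jv ->]]] By.
  rewrite mulrC; apply: (submodM sJ) => //; apply: (submodD sJ).
    by rewrite mulrC; apply: (submodM sJ) => //; apply: AB.
  exact: (submodM sJ).
move=> z Jz; have -> : z = a * (z * b) - c * (w * z) * 1.
  transitivity (z * (a * b) - c * (w * z)); last by ring.
  by rewrite Eab; ring.
apply: (submodB sB (submod_extend _)).
- by apply: imul_in; [apply: Ia|apply: BJJ].
- by apply: imul_in; [apply/Ic/(submodM sJ)|apply: subring1].
Qed.

Lemma has_inverse_lift J : has_inverse B J ->
  exists2 I, has_inverse A I & ideal_mul I B = J.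
Proof.
move=> [sJ [J' sJ' JJ']].
have [|a [b [Ja Jb mab]]] := @local_generator B J J' m sB sJ sJ' smB _ preg JJ'.
  by move=> _ [u Bu <-]; apply: subringM.
by have [iI IB] := model_spec sJ sJ' JJ' Ja Jb mab; exists (model a J).
Qed.

(** Classes are sets of modules, so taking the image of the whole coset needs no choice of a
    representative. *)
Definition extend (X : set (set F)) : set (set F) := [set ideal_mul Y B | Y in X].

Lemma extend_class I : submod A I ->
  extend (ideal_class A I) = ideal_class B (ideal_mul I B).
Proof.
move=> sI; rewrite /extend !ideal_classE //; last exact: submod_extend.
by rewrite image_comp; congr image; apply/funext => e /=; rewrite imul_scalel.
Qed.

Lemma extend_Pic : extend @` Pic A = Pic B.
Proof.
rewrite !PicE // image_comp; apply/seteqP; split=> [_ [I iI <-]|_ [J iJ <-]].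
  exists (ideal_mul I B); first exact: has_inverse_extend.
  by rewrite /= extend_class //; case: iI.
have [I iI <-] := has_inverse_lift iJ; exists I => //=.
by rewrite extend_class //; case: iI.
Qed.

(** In terms of residue rings: the unit group of [B/cB] is generated by the images of the units of
    [B] and of [A/cB]. The quotient by these images is the kernel of the map on Picard groups. *)
Definition residues_lift : Prop := forall a b, B a -> B b -> scale c B (a * b - 1) ->
  exists2 g, unit_of B g & A (a * g).

Let unit_scale g : g != 0 -> scale g B = B -> unit_of B g.
Proof.
move=> g0 gB; split=> //.
  by rewrite -gB; exists 1; [exact: subring1|rewrite mulr1].
have : scale g B 1 by rewrite gB; apply: subring1.
by move/scaleP; rewrite mulr1; apply.
Qed.

(** Such an [L] contains [cB] and is generated modulo [cB] by a single [a]. Once a unit [g] of [B]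
    moves [a] into [A], where [a * g] is invertible modulo [cB], [L] is [g^-1 A]. *)
Lemma extend_principal L : residues_lift -> has_inverse A L -> ideal_mul L B = B ->
  exists2 g, g != 0 & L = scale g A.
Proof.
move=> rl [sL [L' sL' LL']] LB.
have L'B : ideal_mul L' B = B.
  by rewrite -{1}LB imulA [ideal_mul L' L]imulC LL'; apply: imul_over.
have LsB I : ideal_mul I B = B -> I `<=` B.
  by move=> IB x Ix; rewrite -IB -[x]mulr1; apply: imul_in => //; apply: subring1.
have pregA x : A x -> exists2 n, (0 < n)%N & m (x ^+ (n + n) - x ^+ n).
  by move/AB; apply: preg.
have [a [b [La L'b mab]]] := local_generator sA sL sL' smA cBA pregA LL'.
have Ba : B a by apply: LsB La.
have Bb : B b by apply: LsB L'b.
have [g [g0 Bg Bgv] Aag] := rl a b Ba Bb mab.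
exists g^-1; first by rewrite invr_eq0.
(* [cB = c LB = L (cB)], and [cB] lies in [A]. *)
have mL : m `<=` L.
  rewrite /m -LB -imul_scale; apply: (imul_sub sL) => x y Lx cBy.
  by rewrite mulrC; apply: (submodM sL) => //; apply: cBA.
have mB x y : m x -> B y -> m (x * y) by move=> mx By; rewrite mulrC; apply: (submodM smB).
have [w Bw Ew] := mab; have Eab : a * b = 1 + c * w by rewrite Ew; ring.
apply/seteqP; split=> [x Lx|x]; rewrite scaleP ?invr_eq0 // invrK.
  have Axb : A (x * b) by rewrite -LL'; apply: imul_in.
  have -> : g * x = a * g * (x * b) - c * (w * g * x).
    transitivity (g * x * (a * b) - c * (w * g * x)); last by ring.
    by rewrite Eab; ring.
  apply: subringB => //; first exact: subringM.
  by apply: cBA; eexists; last reflexivity; do !apply: subringM => //; apply: LsB Lx.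
move=> Agx.
have mstt : m (a * g * (g^-1 * b) - 1) by rewrite mulrA mulfK.
have Bgb : B (g^-1 * b) by apply: subringM.
have [s' As' mss] := regular_inverse Aag Bgb mstt.
have -> : x = a * (s' * (g * x)) - (a * g * s' - 1) * (g^-1 * (g * x)).
  by rewrite mulKf //; ring.
apply: (submodB sA sL).
  by rewrite mulrC; apply: (submodM sL) => //; apply: subringM.
by apply/mL/mB => //; apply: subringM => //; apply: AB.
Qed.

Lemma extend_inj : residues_lift -> {in Pic A &, injective extend}.
Proof.
move=> rl X Y; rewrite !inE PicE // => -[I [sI [I' sI' II']] <-] [J iJ <-].
have [sJ _] := iJ; have iI : has_inverse A I by split=> //; exists I'.
rewrite !extend_class // eq_ideal_class //; try exact: submod_extend.
move=> -[e e0 eJ].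
rewrite eq_ideal_class //.
(* The quotient of the two ideals, scaled so that its extension is [B] itself and not merely
   principal. *)
pose L := scale e^-1 (ideal_mul I' J).
have iL : has_inverse A L.
  have [_ [J' sJ' JJ']] := iJ.
  split.
    rewrite /L -imul_scale; exact: submod_imul.
  exists (scale e (ideal_mul I J')).
    by rewrite -imul_scale; apply: submod_imul.
  rewrite imul_scale imul_scalel scale_scale divff // scale1.
  by rewrite imulACA (imulC I') II' JJ'; apply: imul_id => //; apply: subring_submod.
have LB : ideal_mul L B = B.
  rewrite /L imul_scalel -imulA eJ imul_scale scale_scale mulVf // scale1.
  by rewrite imulA (imulC I') II'; apply: imul_over.
have [g g0 Lg] := extend_principal rl iL LB.
exists (e * g); first exact: mulf_neq0.
rewrite -[in RHS](imul_id sA sI) -imul_scale -scale_scale -Lg /L scale_scale divff // scale1.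
by rewrite imulA II' imulC imul_id.
Qed.

(* The class of [aA + cB] lies in the kernel of the extension map, and it is
   trivial only if [a] is in [A] up to a unit of [B]. *)
Lemma extend_inj_residues : {in Pic A &, injective extend} -> residues_lift.
Proof.
move=> inj a b Ba Bb mab.
have sBB := subring_submod sB; have sAA := subring_submod sA.
have BB : ideal_mul B B = B by apply: imul_over.
have [iI IB] := model_spec sBB sBB BB Ba Bb mab.
have iA : has_inverse A A by split=> //; exists A => //; apply: imul_id.
have sI := proj1 iI.
have AB' : ideal_mul A B = B by apply: imul_over.
have /eq_ideal_class [] // : ideal_class A A = ideal_class A (model a B).
  apply: inj.
  - by rewrite inE PicE //; exists A.
  - by rewrite inE PicE //; exists (model a B).
  by rewrite !extend_class // IB AB'.
(* Extending [model a B = gA] to [B] gives [B = gB], so [g] is a unit; [a] lies in the model, hence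
   in [gA]. *)
move=> g g0 Ig; have [_ Bg Bgv] : unit_of B g.
  by apply: unit_scale => //; rewrite -[in LHS]AB' -imul_scalel -Ig.
exists g^-1; first by split; rewrite ?invr_eq0 ?invrK.
rewrite mulrC; apply/scaleP => //; rewrite -Ig; exists 1, 0.
by rewrite mulr1 mulr0 addr0; split=> //; [apply: subring1|apply: subring0].
Qed.

Lemma Pic_card_eqP : finite_set (Pic B) -> Pic B #= Pic A <-> residues_lift.
Proof.
move=> finB; split=> [eqBA|rl]; last first.
  by rewrite -extend_Pic; apply: inj_card_eq; apply: extend_inj.
apply: extend_inj_residues; apply: card_image_inj.
  by rewrite -(eq_finite_set eqBA).
by rewrite extend_Pic.
Qed.
End Extension.
End Ideals.

(** * Integers of a real quadratic field *)

Section RealQuadratic.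
Variable d : nat.
Hypotheses (d2 : (2 <= d)%N) (sfd : squarefree d).
Implicit Types (a b u v : rat) (m n p q : int) (z w : quad d).

Let s := sqrtd d.

Lemma quad_inj z w : quad_val z = quad_val w -> z = w.
Proof. exact: val_inj. Qed.

Lemma quad_valD z w : quad_val (z + w) = quad_val z + quad_val w.
Proof. exact: (raddfD (\val : quad d -> algC)). Qed.

Lemma quad_valN z : quad_val (- z) = - quad_val z.
Proof. exact: (raddfN (\val : quad d -> algC)). Qed.

Lemma quad_valM z w : quad_val (z * w) = quad_val z * quad_val w.
Proof. exact: (rmorphM (\val : quad d -> algC)). Qed.

Lemma quad_val_int m : quad_val (m%:~R : quad d) = m%:~R.
Proof. exact: (rmorph_int (\val : quad d -> algC)). Qed.

Lemma quad_val_nat (k : nat) : quad_val (k%:R : quad d) = k%:R.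
Proof. exact: (rmorph_nat (\val : quad d -> algC)). Qed.

Lemma quad_val_rat a : quad_val (ratr a : quad d) = ratr a.
Proof. exact: (fmorph_rat (\val : quad d -> algC)). Qed.

Lemma ratrD_quad a b : ratr (a + b) = ratr a + ratr b :> quad d.
Proof. by apply: quad_inj; rewrite quad_valD !quad_val_rat rmorphD. Qed.

Lemma ratrM_quad a b : ratr (a * b) = ratr a * ratr b :> quad d.
Proof. by apply: quad_inj; rewrite quad_val_rat [RHS]quad_valM !quad_val_rat rmorphM. Qed.

Lemma ratrN_quad a : ratr (- a) = - ratr a :> quad d.
Proof. by apply: quad_inj; rewrite quad_valN !quad_val_rat rmorphN. Qed.

Lemma ratrB_quad a b : ratr (a - b) = ratr a - ratr b :> quad d.
Proof. by rewrite ratrD_quad ratrN_quad. Qed.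

Lemma ratr_int_quad m : ratr m%:~R = m%:~R :> quad d.
Proof. by rewrite ratr_int. Qed.

Lemma ratr_nat_quad (k : nat) : ratr k%:R = k%:R :> quad d.
Proof. by rewrite ratr_nat. Qed.

Lemma sqrtd_sqr : s * s = d%:R.
Proof. by apply: quad_inj; rewrite quad_valM -expr2 sqrtCK quad_val_nat. Qed.

Lemma quad_coords z : exists a b, z = ratr a + ratr b * s.
Proof.
have /in_quadP[a [b E]] := quad_valP z; exists a, b.
by apply: quad_inj; rewrite quad_val_ratr.
Qed.

Lemma quad_coords_inj a b a' b' :
  ratr a + ratr b * s = ratr a' + ratr b' * s -> a = a' /\ b = b'.
Proof.
move/(congr1 (@quad_val d)); rewrite !quad_val_ratr => Eab.
have Es : ratr (b - b') * sqrtC d%:R = ratr (a' - a) :> algC.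
  apply/eqP; rewrite -subr_eq0 !rmorphB /=; apply/eqP.
  transitivity (ratr a + ratr b * sqrtC d%:R - (ratr a' + ratr b' * sqrtC d%:R) : algC).
    by ring.
  by rewrite Eab subrr.
have [/subr0_eq Eb|Nb] := eqVneq (b - b') 0.
  by move: Eab; rewrite Eb => /addIr /fmorph_inj ->.
case/eqP: (sqrtd_irrational ((a' - a) / (b - b')) d2 sfd).
by rewrite fmorph_div /= -Es mulrAC divff ?mul1r // fmorph_eq0.
Qed.

Lemma quad_normM z w : quad_norm (z * w) = quad_norm z * quad_norm w.
Proof.
have [a [b ->]] := quad_coords z; have [a' [b' ->]] := quad_coords w.
have -> : (ratr a + ratr b * s) * (ratr a' + ratr b' * s) =
    ratr (a * a' + d%:R * b * b') + ratr (a * b' + b * a') * s.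
  rewrite !(ratrD_quad, ratrM_quad) ratr_nat_quad -sqrtd_sqr; ring.
rewrite !quad_normE //; ring.
Qed.

Lemma quad_norm1 : quad_norm (1 : quad d) = 1.
Proof.
have -> : 1 = ratr 1 + ratr 0 * s.
  by rewrite (ratr_nat_quad 1) (ratr_nat_quad 0) mul0r addr0.
by rewrite quad_normE //; ring.
Qed.

Lemma quad_norm_neq0 z : z != 0 -> quad_norm z != 0.
Proof.
move=> z0; apply/eqP => Nz0; case/eqP: (oner_neq0 rat).
by rewrite -quad_norm1 -(divff z0) quad_normM Nz0 mul0r.
Qed.

(** [tau] and [- nu] are the trace and the norm of [omega d], so [omega^2 = tau * omega + nu] covers
    both shapes of [omega] at once. *)
Definition tau : int := if (d %% 4 == 1)%N then 1 else 0.
Definition nu : int := if (d %% 4 == 1)%N then (d.-1 %/ 4)%N%:Z else d%:Z.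
Definition qz m n : quad d := m%:~R + n%:~R * omega d.
Definition nrm m n : int := m * m + tau * m * n - nu * n * n.

Lemma tau_nu1 : (d %% 4 == 1)%N -> tau = 1 /\ d%:Z = 1 + 4 * nu.
Proof. by rewrite /tau /nu => d1; rewrite d1; split=> //; lia. Qed.

Lemma tau_nu2 : (d %% 4 == 1)%N = false -> tau = 0 /\ nu = d%:Z.
Proof. by rewrite /tau /nu => ->. Qed.

Lemma two_neq0 : 2%:R != 0 :> quad d.
Proof.
apply/eqP => /(congr1 (@quad_val d)); rewrite quad_val_nat (quad_val_nat 0).
by apply/eqP; rewrite pnatr_eq0.
Qed.

Lemma omega_eq : (d %% 4 == 1)%N -> 2%:R * omega d = 1 + s.
Proof. by rewrite /omega => ->; rewrite mulrC divfK // two_neq0. Qed.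

Lemma omega_sqr : omega d * omega d = tau%:~R * omega d + nu%:~R.
Proof.
case d1: (d %% 4 == 1)%N; last first.
  by have [-> ->] := tau_nu2 d1; rewrite /omega d1 sqrtd_sqr mul0r add0r.
have [-> dE] := tau_nu1 d1; have E := omega_eq d1.
have Es : s = 2%:R * omega d - 1 by rewrite E; ring.
have E4 : (4%:R : quad d) * (omega d * omega d - omega d - nu%:~R) = 0.
  transitivity (s * s - (1 + 4%:Z * nu)%:~R); first by rewrite Es; ring.
  by rewrite -dE sqrtd_sqr subrr.
have f4 : 4%:R != 0 :> quad d by rewrite (natrM _ 2 2) mulf_neq0 // two_neq0.
move/eqP: E4; rewrite mulf_eq0 (negPf f4) /= => /eqP E4.
by apply/eqP; rewrite -subr_eq0 -E4; apply/eqP; ring.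
Qed.

Lemma qzM m n p q :
  qz m n * qz p q = qz (m * p + nu * n * q) (m * q + n * p + tau * n * q).
Proof.
transitivity (m%:~R * p%:~R + (m * q + n * p)%:~R * omega d
   + n%:~R * q%:~R * (omega d * omega d)); first by rewrite /qz; ring.
by rewrite omega_sqr /qz; ring.
Qed.

Lemma qzD m n p q : qz m n + qz p q = qz (m + p) (n + q).
Proof. by rewrite /qz; ring. Qed.

Lemma qzB m n p q : qz m n - qz p q = qz (m - p) (n - q).
Proof. by rewrite /qz; ring. Qed.

Lemma qz_int m : qz m 0 = m%:~R.
Proof. by rewrite /qz; ring. Qed.

Lemma qz_scale (m n p : int) : p%:~R * qz m n = qz (p * m) (p * n).
Proof. by rewrite /qz; ring. Qed.

Lemma qz_coords m n : exists a b, [/\ qz m n = ratr a + ratr b * s,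
   2 * a = (2 * m + tau * n)%:~R,
   (d %% 4 == 1)%N -> 2 * b = n%:~R & (d %% 4 == 1)%N = false -> b = n%:~R].
Proof.
case d1: (d %% 4 == 1)%N; last first.
  have [-> _] := tau_nu2 d1; exists m%:~R, n%:~R; split=> //; last first.
    by rewrite mul0r addr0 intrM.
  by rewrite /qz /omega d1 !ratr_int_quad.
have [-> _] := tau_nu1 d1; exists (m%:~R + n%:~R / 2), (n%:~R / 2).
split; [|by rewrite intrD !intrM; field|by move=> _; field|by []].
apply: (mulfI two_neq0); rewrite /qz mulrDr mulrCA omega_eq // -!ratr_int_quad.
rewrite ratrD_quad; set h := n%:~R / 2; have -> : n%:~R = h + h by rewrite /h; field.
by rewrite ratrD_quad; ring.
Qed.

Lemma quad_norm_qz m n : quad_norm (qz m n) = (nrm m n)%:~R.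
Proof.
have [a [b [-> Ea E1 E2]]] := qz_coords m n; rewrite quad_normE //.
have -> : a = (2 * m + tau * n)%:~R / 2 by rewrite -Ea; field.
rewrite /nrm; case d1: (d %% 4 == 1)%N; last first.
  by rewrite E2 //; have [-> ->] := tau_nu2 d1; rewrite -[d%:R]/(d%:Z%:~R); field.
have -> : b = n%:~R / 2 by rewrite -E1 //; field.
have [-> dE] := tau_nu1 d1; rewrite -[d%:R]/(d%:Z%:~R) dE; by field.
Qed.

Lemma qz_inj m n p q : qz m n = qz p q -> m = p /\ n = q.
Proof.
have [a [b [-> Ea E1 E2]]] := qz_coords m n.
have [a' [b' [-> Ea' E1' E2']]] := qz_coords p q.
move/quad_coords_inj => [aa bb]; subst a' b'.
have nq : n = q.
  case d1: (d %% 4 == 1)%N; apply: (@intr_inj rat).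
    by rewrite -E1 // -E1'.
  by rewrite -E2 // -E2'.
split=> //; move: Ea; rewrite Ea' nq => /intr_inj; lia.
Qed.

Lemma nrmM m n p q : nrm m n * nrm p q =
  nrm (m * p + nu * n * q) (m * q + n * p + tau * n * q).
Proof. by rewrite /nrm; ring. Qed.

Lemma ringint_qz m n : ringint (qz m n).
Proof.
have Aw : quad_val (omega d) \in Aint.
  have vw := congr1 (@quad_val d) omega_sqr.
  apply: (@root_monic_Aint ('X^2 - (tau%:~R *: 'X + (nu%:~R)%:P))).
  - rewrite rootE !hornerE; apply/eqP; move: vw.
    rewrite quad_valM quad_valD quad_valM !quad_val_int => vw.
    by rewrite expr2 vw; ring.
  - rewrite monicE lead_coefDl ?lead_coefXn // size_opp size_polyXn ltnS.
    by rewrite (leq_trans (size_polyD _ _)) // geq_max (leq_trans (size_scale_leq _ _))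
      ?size_polyX // (leq_trans (size_polyC_leq1 _)).
  - apply/polyOverP => i; rewrite coefB coefXn coefD coefZ coefX coefC.
    rewrite rpredB ?rpred_nat // rpredD ?rpredM ?rpred_nat ?rpred_int //.
    by case: eqP => _; rewrite ?rpred_int ?rpred0.
suff : quad_val (m%:~R + n%:~R * omega d) \in Aint by [].
rewrite quad_valD quad_valM !quad_val_int.
by rewrite rpredD ?rpredM ?Aint_int ?rpred_int.
Qed.

Lemma ratr_Cint a : ratr a \in (Num.int : {pred algC}) -> exists m, a = m%:~R.
Proof.
by move/intrP=> [m E]; exists m; apply: (fmorph_inj (ratr : rat -> algC)); rewrite /= E ratr_int.
Qed.

(** For [b != 0] the minimal polynomial of the element is [X^2 - 2 a X + (a^2 - d b^2)], and an
    algebraic integer has a minimal polynomial with integer coefficients. *)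
Lemma ringint_trace_norm a b : ringint (ratr a + ratr b * s) ->
  (exists m, 2 * a = m%:~R) /\ (exists m, a ^+ 2 - d%:R * b ^+ 2 = m%:~R).
Proof.
move=> Ax; have {Ax} : quad_val (ratr a + ratr b * sqrtd d) \in Aint by [].
rewrite quad_val_ratr; set x := _ + _ => Ax.
have [b0|b0] := eqVneq b 0.
  move: Ax; rewrite /x b0 rmorph0 mul0r addr0 => Aa.
  have [|m ->] := @ratr_Cint a; first exact: Cint_rat_Aint (Crat_rat _) Aa.
  by split; [exists (2 * m); rewrite intrM|exists (m * m); rewrite intrM; ring].
have [c1 Ec1] : exists c, c = 2 * a by eexists.
have [c0 Ec0] : exists c, c = a ^+ 2 - d%:R * b ^+ 2 by eexists.
rewrite -Ec1 -Ec0; pose q : {poly rat} := 'X^2 - (c1 *: 'X - c0%:P).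
have szq : leq (size (c1 *: 'X - c0%:P)) 2.
  rewrite (leq_trans (size_polyD _ _)) // geq_max (leq_trans (size_scale_leq _ _))
    ?size_polyX // size_opp (leq_trans (size_polyC_leq1 _)) //.
have size_q : size q = 3%N by rewrite size_polyDl size_polyXn ?size_opp.
have mon_q : q \is monic by rewrite monicE lead_coefDl ?lead_coefXn // size_opp size_polyXn.
have [p [Dp mon_p] dv_p] := minCpolyP x.
have qx : root (map_poly (ratr : rat -> algC) q) x.
  rewrite /q !rmorphB /= map_polyXn map_polyZ map_polyX map_polyC /=.
  rewrite rootE !hornerE Ec1 Ec0 rmorphB !rmorphM /= ?rmorphXn /= !rmorph_nat.
  by rewrite -(sqrtCK (d%:R : algC)) /x; apply/eqP; ring.
have pq : p %| q by rewrite -dv_p.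
have q0 : q != 0 by apply: monic_neq0.
have szp := dvdp_leq q0 pq.
have szp1 : (1 < size p)%N by rewrite -(size_map_poly (ratr : rat -> algC)) -Dp size_minCpoly.
have szp2 : size p != 2%N.
  apply/eqP => sz2; have := root_minCpoly x; rewrite Dp rootE horner_coef size_map_poly sz2.
  have p1 : p`_1 = 1 by move/monicP: mon_p; rewrite lead_coefE sz2.
  rewrite big_ord_recl big_ord1 !coef_map /= p1 rmorph1 mulr1 mul1r expr1 => /eqP E.
  case/eqP: b0; suff [] : a + p`_0 = 0 /\ b = 0 by [].
  apply: quad_coords_inj.
  apply: quad_inj; rewrite !quad_val_ratr rmorphD /= !rmorph0 mul0r addr0 -E /x.
  ring.
have /eqP Epq : p == q.
  rewrite -eqp_monic // -dvdp_size_eqp // size_q eqn_leq.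
  by rewrite size_q in szp; rewrite szp ltn_neqAle eq_sym szp2.
move: Ax; rewrite unfold_in Dp Epq => /polyOverP Iq; split.
  have := Iq 1%N; rewrite coef_map /= !(coefB, coefZ) coefXn coefX coefC /= => /ratr_Cint[m].
  by rewrite mulr1 subr0 sub0r => E; exists (- m); rewrite mulrNz -E opprK.
have := Iq 0%N; rewrite coef_map /= !(coefB, coefZ) coefXn coefX coefC /= => /ratr_Cint[m].
by rewrite mulr0 !sub0r opprK => E; exists m.
Qed.

(** The squared denominator of [a] divides [d] times the squared numerator and is coprime to the
    latter, hence divides [d]. *)
Lemma squarefree_denominator a m : d%:R * a ^+ 2 = m%:~R -> exists n, a = n%:~R.
Proof.
move=> E; exists (numq a); suff d1 : denq a = 1 by rewrite -[LHS]divq_num_den d1 divr1.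
have den0 : (denq a)%:~R != 0 :> rat by rewrite intr_eq0 denq_neq0.
have : d%:Z * numq a ^+ 2 = m * denq a ^+ 2.
  by apply: (@intr_inj rat); rewrite !expr2 !intrM -E numqE -[d%:R]/(d%:Z%:~R); ring.
move/(congr1 absz); rewrite !abszM !mulnn => E'.
have : (`|denq a| ^ 2 %| d)%N.
  rewrite -(@Gauss_dvdl _ _ (`|numq a| ^ 2)).
    by rewrite E' dvdn_mull.
  by rewrite coprimeXl // coprimeXr // coprime_sym coprime_num_den.
by move/sfd => dE; rewrite -[denq a]gez0_abs ?denq_ge0 // dE.
Qed.

Lemma int_parity m : exists n, m = 2 * n \/ m = 2 * n + 1.
Proof. exists (m %/ 2)%Z; lia. Qed.

Lemma ringintE : @ringint d = [set z | exists m n, z = qz m n].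
Proof.
apply/seteqP; split=> [z|_ [m [n ->]]]; last exact: ringint_qz.
have [a [b ->]] := quad_coords z => /ringint_trace_norm[[t Et] [N EN]].
(* [d (2 b)^2 = t^2 - 4 N] is an integer, so [2 b] is one too. What remains is the parity of [t] and
   [u] in [t^2 - d u^2 = 4 N]. *)
have [|u Eu] := @squarefree_denominator (2 * b) (t * t - 4 * N).
  rewrite intrB !intrM -Et -EN; ring.
have tuN : t * t - d%:Z * u * u = 4 * N.
  apply: (@intr_inj rat); rewrite intrB !intrM -Et -Eu -EN -[d%:Z%:~R]/(d%:R); ring.
have d4 : (d %% 4 != 0)%N.
  by apply/negP => dd; have := @sfd 2 dd.
have coordE (m n : int) : 2%:R * qz m n = (2 * m)%:~R + n%:~R * (2%:R * omega d).
  by rewrite /qz; ring.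
have zE : 2%:R * (ratr a + ratr b * s) = t%:~R + u%:~R * s.
  by rewrite -!ratr_int_quad -Et -Eu !ratrM_quad ratr_nat_quad; ring.
have [t' tE] := int_parity t; have [u' uE] := int_parity u.
have [k kE] : exists k : int, d%:Z = 4 * k + (d %% 4)%N by exists (d %/ 4)%N%:Z; lia.
case d1: (d %% 4 == 1)%N.
  exists (t' - u'), u; apply: (mulfI two_neq0).
  rewrite zE coordE omega_eq //; have -> : t = 2 * (t' - u') + u.
    rewrite kE (eqP d1) in tuN.
    by case: tE => tE; case: uE => uE; rewrite tE uE in tuN *; lia.
  by ring.
exists t', u'; apply: (mulfI two_neq0); rewrite zE coordE /omega d1.
(* Squares are [0] or [1] modulo 4, so for [d] equal to 2 or 3 modulo 4 both [t] and [u] are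
   even. *)
have [-> ->] : t = 2 * t' /\ u = 2 * u'.
  have [k2|k3] : d%:Z = 4 * k + 2 \/ d%:Z = 4 * k + 3 by lia.
    by rewrite k2 in tuN; case: tE => tE; case: uE => uE; rewrite tE uE in tuN *; lia.
  by rewrite k3 in tuN; case: tE => tE; case: uE => uE; rewrite tE uE in tuN *; lia.
by rewrite -/s; ring.
Qed.
End RealQuadratic.

(** * Orders and finiteness of the class group *)

Lemma pigeonhole (T : finType) (N : nat) (h : nat -> T) : (#|T| < N)%N ->
  exists i j, [/\ (i < j)%N, (j < N)%N & h i = h j].
Proof.
move=> TN; have : ~~ injectiveb (fun i : 'I_N => h i).
  apply/negP => /injectiveP/leq_card; rewrite card_ord.
  by rewrite leqNgt TN.
case/injectivePn => i [j ij hij]; case: (ltngtP i j) => [lt|lt|E].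
- by exists i, j.
- by exists j, i.
- by case/eqP: ij; apply: val_inj.
Qed.

Section Orders.
Variable d : nat.
Hypotheses (d2 : (2 <= d)%N) (sfd : squarefree d).
Implicit Types (a b u v : rat) (m n p q : int) (z w : quad d) (f : nat).

Let ringintE := ringintE d2 sfd.
Let B := @ringint d.

Lemma subring_ringint : subring B.
Proof.
rewrite /B ringintE; split.
- by exists 1, 0; rewrite qz_int.
- by move=> _ _ [m [n ->]] [p [q ->]]; exists (m - p), (n - q); rewrite qzB.
- by move=> _ _ [m [n ->]] [p [q ->]]; rewrite (qzM d2); eexists; eexists.
Qed.

Lemma orderE f : @order_cond d f = [set z | exists m n, z = qz d m (f%:Z * n)].
Proof.
apply/seteqP; split=> [_ [m [w + ->]]|_ [m [n ->]]].
  by rewrite ringintE => -[p [q ->]]; exists (m + f%:Z * p), q; rewrite /qz; ring.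
exists m, (qz d 0 n); last by rewrite /qz; ring.
exact: (ringint_qz d2).
Qed.

Lemma order_qz f m n : order_cond f (qz d m n) <-> (f%:Z %| n)%Z.
Proof.
rewrite orderE; split=> [[p [q /(qz_inj d2 sfd)[_ ->]]]|/dvdzP[q ->]].
  exact: dvdz_mulr.
by exists m, q; rewrite mulrC.
Qed.

Lemma order_sub f : @order_cond d f `<=` B.
Proof. by rewrite orderE => _ [m [n ->]]; apply: (ringint_qz d2). Qed.

Lemma order1 : @order_cond d 1 = B.
Proof.
rewrite orderE /B ringintE; apply/seteqP; split=> _ [m [n ->]].
  by exists m, (1 * n).
by exists m, n; rewrite mul1r.
Qed.

Lemma subring_order f : subring (@order_cond d f).
Proof.
rewrite orderE; split.
- by exists 1, 0; rewrite mulr0 qz_int.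
- move=> _ _ [m [n ->]] [p [q ->]]; exists (m - p), (n - q).
  by rewrite qzB mulrBr.
- move=> _ _ [m [n ->]] [p [q ->]]; rewrite (qzM d2).
  exists (m * p + nu d * (f%:Z * n) * (f%:Z * q)),
    (m * q + n * p + tau d * (f%:Z * n) * q).
  by congr qz; ring.
Qed.

Lemma order_nat f (k : nat) : order_cond f (k%:R : quad d).
Proof. by rewrite -[k%:R]/(k%:Z%:~R) -qz_int order_qz dvdz0. Qed.

Lemma scale_qz f m n : (0 < f)%N ->
  scale f%:R B (qz d m n) <-> (f%:Z %| m)%Z /\ (f%:Z %| n)%Z.
Proof.
move=> f0; split=> [[w]|[/dvdzP[p ->] /dvdzP[q ->]]].
  rewrite /B ringintE => -[p [q ->]].
  rewrite -[f%:R]/(f%:Z%:~R) qz_scale => /(qz_inj d2 sfd)[<- <-].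
  by rewrite !dvdz_mulr.
exists (qz d p q); first exact: (ringint_qz d2).
by rewrite -[f%:R]/(f%:Z%:~R) qz_scale ![_ * f%:Z]mulrC.
Qed.

Lemma scale_order f : scale f%:R B `<=` @order_cond d f.
Proof.
move=> x [w]; rewrite /B ringintE => -[p [q ->]] <-.
by rewrite -[f%:R]/(f%:Z%:~R) qz_scale order_qz dvdz_mulr.
Qed.

Lemma natr_quad_neq0 f : (0 < f)%N -> f%:R != 0 :> quad d.
Proof.
move=> f0; apply/eqP => /(congr1 (@quad_val d)); rewrite quad_val_nat (quad_val_nat d 0).
by apply/eqP; rewrite pnatr_eq0 -lt0n.
Qed.

Lemma ringint_sqrtd : B (sqrtd d).
Proof.
case d1: (d %% 4 == 1)%N; last first.
  have -> : sqrtd d = qz d 0 1 by rewrite /qz /omega d1; ring.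
  exact: (ringint_qz d2).
have -> : sqrtd d = qz d (- 1) 2; last exact: (ringint_qz d2).
transitivity (2%:R * omega d - 1); first by rewrite omega_eq //; ring.
by rewrite /qz; ring.
Qed.

Lemma rat_natmul (a : rat) : exists k m, (0 < k)%N /\ k%:R * a = m%:~R.
Proof.
exists `|denq a|%N, (numq a); rewrite absz_gt0 denq_neq0; split=> //.
rewrite -[_%:R]/(`|denq a|%N%:Z%:~R) gez0_abs ?denq_ge0 //.
by rewrite numqE mulrC.
Qed.

Lemma fraction_order f : (0 < f)%N -> fraction_ring (@order_cond d f).
Proof.
move=> f0 z; have [a [b ->]] := quad_coords z.
have [k [m [k0 km]]] := rat_natmul a; have [l [n [l0 ln]]] := rat_natmul b.
(* [k] and [l] clear the denominators; the factor [f] moves the result into [fB], which lies in the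
   order. *)
exists (f * k * l)%:R; split; first exact: order_nat.
  by rewrite natr_quad_neq0 // !muln_gt0 f0 k0.
apply: scale_order.
exists (l%:R * m%:~R + k%:R * n%:~R * sqrtd d).
  have sB := subring_ringint.
  have Bi q : B q%:~R by rewrite -qz_int; apply: (ringint_qz d2).
  apply: (subringD sB); first exact: (subringM sB (Bi l) (Bi m)).
  exact: (subringM sB (subringM sB (Bi k) (Bi n)) ringint_sqrtd).
by rewrite -!ratr_int_quad -km -ln !ratrM_quad !ratr_nat_quad; ring.
Qed.

(** There are only [f^2] residues modulo [f], so the powers of [z] are eventually periodic. *)
Lemma ringint_regular f z : (0 < f)%N -> B z ->
  exists2 n, (0 < n)%N & scale f%:R B (z ^+ (n + n) - z ^+ n).
Proof.
move=> f0 Bz; have sB := subring_ringint.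
have /choice[g gE] i : exists p : int * int, z ^+ i = qz d p.1 p.2.
  have := subringX i sB Bz; rewrite {1}/B ringintE => -[m [n ->]].
  by exists (m, n).
have fz : f%:Z != 0 by lia.
have fp : 0 < f%:Z by lia.
have ltf m : (`|(m %% f%:Z)%Z| < f)%N.
  by have := modz_ge0 m fz; have := ltz_pmod m fp; lia.
pose r (m : int) : 'I_f := Ordinal (ltf m).
have rE m n : r m = r n -> (f%:Z %| m - n)%Z.
  move/(congr1 val) => /= E; rewrite -eqz_mod_dvd.
  by have := modz_ge0 m fz; have := modz_ge0 n fz; lia.
have [|i [j [ij _ E]]] :=
    @pigeonhole _ (f * f).+1 (fun i => (r (g i).1, r (g i).2)).
  by rewrite card_prod !card_ord.
have h1 := rE _ _ (congr1 fst (esym E)); have h2 := rE _ _ (congr1 snd (esym E)).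
have smB : submod B (scale f%:R B) by apply/submod_scale/subring_submod.
have per k t : (i <= k)%N -> scale f%:R B (z ^+ (k + (j - i) * t) - z ^+ k).
  elim: t k => [|t IHt] k ik; first by rewrite muln0 addn0 subrr; case: smB.
  have -> : z ^+ (k + (j - i) * t.+1) - z ^+ k =
      (z ^+ (k + (j - i) + (j - i) * t) - z ^+ (k + (j - i)))
      + z ^+ (k - i) * (z ^+ j - z ^+ i).
    rewrite mulrBr -!exprD (_ : (k - i + j = k + (j - i))%N); last lia.
    by rewrite (_ : (k - i + i = k)%N) ?mulnS ?addnA; [ring|lia].
  apply: (submodD smB); first by apply: IHt; lia.
  apply: (submodM smB); first exact: subringX.
  by rewrite !gE qzB; apply/scale_qz.
(* A multiple of the period [j - i] beyond the preperiod [i]; taking [i.+1] keeps it positive when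
   [i = 0]. *)
exists ((j - i) * i.+1)%N; first by rewrite muln_gt0 subn_gt0 ij.
by apply: per; nia.
Qed.

(** Dirichlet's box argument: the fractional parts of [d^2 + 1] multiples of [(a, b)] fall into
    [d^2] boxes of side [1/d]. *)
Lemma close_multiple (a b : rat) : exists t m n, [/\ (0 < t <= d * d)%N,
  (d%:R * (t%:R * a - m%:~R)) ^+ 2 < 1 & (d%:R * (t%:R * b - n%:~R)) ^+ 2 < 1].
Proof.
pose fr (a : rat) : rat := a - (Num.floor a)%:~R.
have frP c : 0 <= fr c < 1.
  by have := floor_itv c; rewrite /fr intrD; lra.
have ltd c : (Num.truncn (d%:R * fr c) < d)%N.
  have d0 : 0 < d%:R :> rat by rewrite ltr0n; lia.
  have /andP[f0 f1] := frP c.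
  rewrite truncn_lt_nat; last by rewrite mulr_ge0 // ltW.
  by rewrite gtr_pMr.
pose r (t : nat) := (Ordinal (ltd (t%:R * a)), Ordinal (ltd (t%:R * b))).
have [|i [j [ij jd E]]] := @pigeonhole _ (d * d).+1 r.
  by rewrite card_prod !card_ord.
have close c : Num.truncn (d%:R * fr (i%:R * c)) = Num.truncn (d%:R * fr (j%:R * c)) ->
    (d%:R * ((j - i)%:R * c - (Num.floor (j%:R * c) - Num.floor (i%:R * c))%:~R)) ^+ 2 < 1.
  move=> EF; rewrite natrB 1?ltnW // intrB.
  have pos k : 0 <= d%:R * fr (k%:R * c).
    by rewrite mulr_ge0 //; case/andP: (frP (k%:R * c)).
  have := truncn_itv (pos i); have := truncn_itv (pos j).
  rewrite EF; set T := Num.truncn _; rewrite -natr1.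
  rewrite /fr => /andP[A1 A2] /andP[A3 A4].
  set X := d%:R * _; have X1 : - 1 < X < 1 by apply/andP; split; rewrite /X; lra.
  by case/andP: X1 => X1 X2; nra.
exists (j - i)%N, (Num.floor (j%:R * a) - Num.floor (i%:R * a)),
  (Num.floor (j%:R * b) - Num.floor (i%:R * b)); split; [lia| |].
  exact/close/(congr1 (fun x => val x.1) E).
exact/close/(congr1 (fun x => val x.2) E).
Qed.

(** A weak Euclidean division. The side [1/d] of the boxes is small enough for the norm: if [u^2]
    and [v^2] are below [1/d^2], then [u^2] and [d v^2] are below [1]. *)
Lemma near_ringint z : exists t w, [/\ (0 < t <= d * d)%N, B w &
  `|quad_norm (t%:R * z - w)| < 1].
Proof.
have [a [b ->]] := quad_coords z.
have [t [m [n [t0 ta tb]]]] := close_multiple a b.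
have sB := subring_ringint.
have Bi q : B q%:~R by rewrite -qz_int; apply: (ringint_qz d2).
exists t, (m%:~R + n%:~R * sqrtd d); split=> //.
  exact: (subringD sB (Bi m) (subringM sB (Bi n) ringint_sqrtd)).
have -> : t%:R * (ratr a + ratr b * sqrtd d) - (m%:~R + n%:~R * sqrtd d) =
    ratr (t%:R * a - m%:~R) + ratr (t%:R * b - n%:~R) * sqrtd d.
  by rewrite !ratrB_quad !ratrM_quad !ratr_int_quad !ratr_nat_quad; ring.
rewrite quad_normE //; move: ta tb; set u := _ - _; set v := _ - _.
have dge : 2 <= d%:R :> rat by rewrite (ler_nat _ 2).
have := sqr_ge0 u; have := sqr_ge0 v; rewrite !exprMn.
move: (u ^+ 2) (v ^+ 2) (d%:R : rat) dge => U V D D2 V0 U0 DU DV.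
have D1 : 0 <= D - 1 by lra.
have DV0 : 0 <= (D - 1) * (D * V) by do 2 apply: mulr_ge0 => //; lra.
have DU0 : 0 <= (D - 1) * ((D + 1) * U) by do 2 apply: mulr_ge0 => //; lra.
have DV1 : D * V < 1 by move: DV DV0; rewrite expr2; lra.
have U1 : U < 1 by move: DU DU0; rewrite expr2; lra.
have DVp : 0 <= D * V by apply: mulr_ge0 => //; lra.
by rewrite ltr_norml; apply/andP; split; lra.
Qed.

(** Such a [J] is a union of cosets of [MB], hence determined by a set of residues modulo [M]. *)
Lemma finite_ideals_between M : (0 < M)%N ->
  finite_set [set J : set (quad d) |
    [/\ submod B J, J `<=` B & scale M%:R B `<=` J]].
Proof.
case: M => // M _.
pose g (X : {set 'I_M.+1 * 'I_M.+1}) : set (quad d) := [set z | exists k,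
  k \in X /\ exists2 w, B w & z = qz d (k.1 : nat)%:Z (k.2 : nat)%:Z + M.+1%:R * w].
apply: (@sub_finite_set _ _ (g @` setT)); last by apply: finite_image; apply: finite_finset.
move=> J [sJ JB MJ]; have sB := subring_ringint.
exists [set k : 'I_M.+1 * 'I_M.+1 | `[< J (qz d (k.1 : nat)%:Z (k.2 : nat)%:Z) >]]%SET => //.
apply/seteqP; split=> [z [k [+ [w Bw ->]]]|z Jz].
  rewrite inE => /asboolP Jk; apply: (submodD sJ) => //.
  by apply: MJ; exists w.
have := JB z Jz; rewrite {1}/B ringintE => -[m [n Ez]].
have M0 : M.+1%:Z != 0 by [].
have Mp : 0 < M.+1%:Z by [].
have ltM q : (`|(q %% M.+1%:Z)%Z| < M.+1)%N.
  by have := modz_ge0 q M0; have := ltz_pmod q Mp; lia.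
have absM q : `|(q %% M.+1%:Z)%Z|%N%:Z = (q %% M.+1%:Z)%Z.
  by rewrite gez0_abs // modz_ge0.
have dec : z = qz d (m %% M.+1%:Z)%Z (n %% M.+1%:Z)%Z
    + M.+1%:R * qz d (m %/ M.+1%:Z)%Z (n %/ M.+1%:Z)%Z.
  rewrite -[M.+1%:R]/(M.+1%:Z%:~R) qz_scale qzD Ez {1}(divz_eq m M.+1%:Z).
  by rewrite {1}(divz_eq n M.+1%:Z); congr qz; rewrite addrC [_ * M.+1%:Z]mulrC.
have Bq p q : B (qz d p q) by apply: (ringint_qz d2).
exists (Ordinal (ltM m), Ordinal (ltM n)); split.
  rewrite inE /= !absM; apply/asboolP.
  have -> : qz d (m %% M.+1%:Z)%Z (n %% M.+1%:Z)%Z =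
    z - M.+1%:R * qz d (m %/ M.+1%:Z)%Z (n %/ M.+1%:Z)%Z by rewrite dec addrK.
  by apply: (submodB sB sJ) => //; apply: MJ; exists (qz d (m %/ M.+1%:Z)%Z (n %/ M.+1%:Z)%Z).
by exists (qz d (m %/ M.+1%:Z)%Z (n %/ M.+1%:Z)%Z); rewrite /= ?absM.
Qed.

Lemma fraction_ringint : fraction_ring B.
Proof. by rewrite -order1; apply: fraction_order. Qed.

(** Hurwitz's argument: with [b] of least nonzero norm in an integral ideal [I0], each [z] in [I0]
    has a multiple [t z] in [bB] with [t <= d^2]. So [(M/b) I0] lies between [MB] and [B] for
    [M = (d^2)!], a multiple of all these [t]. *)
Lemma finite_Pic : finite_set (Pic B).
Proof.
have sB := subring_ringint; have fB := fraction_ringint.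
pose M := ((d * d)`!)%N.
have M0 : (0 < M)%N by apply: fact_gt0.
apply: sub_finite_set (finite_image (ideal_class B) (finite_ideals_between M0)).
rewrite PicE // => _ [I iI <-].
have [[[x Ix x0] _ _ [c0 [Bc0 c00 c0I]]] _] := (invertible_idealE I sB fB).2 iI.
have sI := iI.1; pose I0 := scale c0 I.
have sI0 : submod B I0 by apply: submod_scale.
have I0B y : I0 y -> B y by move=> [u Iu <-]; apply: c0I.
have nI0 y : I0 y -> exists k : nat, `|quad_norm y| = k%:R.
  move=> /I0B; rewrite /B ringintE => -[m [n ->]]; exists `|nrm d m n|%N.
  by rewrite quad_norm_qz // -intr_norm natr_absz.
pose P k := `[< exists y, [/\ I0 y, y != 0 & `|quad_norm y| = k%:R] >].
have exP : exists k, P k.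
  have I0x : I0 (c0 * x) by exists x.
  have [k Ek] := nI0 _ I0x; exists k; apply/asboolP; exists (c0 * x).
  by split=> //; apply: mulf_neq0.
case: (ex_minnP exP) => k /asboolP[b [I0b b0 Nb]] mink.
have dvd_b z : I0 z -> B (M%:R / b * z).
  move=> I0z; have [t [w [/andP[t0 td] Bw Nw]]] := near_ringint (z / b).
  (* [y] lies in [I0] and its norm is smaller than that of [b], so minimality forces [y = 0]. *)
  pose y := t%:R * z - w * b.
  have yE : y = b * (t%:R * (z / b) - w) by rewrite /y; field.
  have I0y : I0 y.
    apply: (submodB sB sI0); last exact: (submodM sI0).
    by apply: (submodM sI0) => //; apply/order_sub/(order_nat 1).
  have y0 : y = 0.
    apply/eqP; apply/negPn/negP => y0; have [l El] := nI0 y I0y.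
    have /mink : P l by apply/asboolP; exists y.
    rewrite leqNgt => /negP; apply; rewrite -(ltr_nat rat) -El -Nb yE quad_normM //.
    by rewrite normrM gtr_pMr // normr_gt0 quad_norm_neq0.
  have tM : (t %| M)%N by apply: dvdn_fact; rewrite t0.
  have -> : M%:R / b * z = (M %/ t)%:R * w.
    rewrite -{1}(divnK tM) natrM.
    have -> : w = t%:R * z / b.
      by apply: (mulIf b0); rewrite divfK //; apply/eqP; rewrite eq_sym -subr_eq0 -/y y0.
    by field.
  by apply: (subringM sB) => //; apply/order_sub/(order_nat 1).
have Mb0 : M%:R / b != 0 by rewrite mulf_neq0 ?invr_eq0 ?natr_quad_neq0.
exists (scale (M%:R / b) I0).
  split; [exact: submod_scale|by move=> _ [a I0a <-]; apply: dvd_b|].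
  move=> _ [w Bw <-]; exists (w * b); first exact: (submodM sI0).
  by field.
apply/esym/eq_ideal_class => //; first exact: submod_scale.
exists (M%:R / b * c0); first exact: mulf_neq0.
by rewrite /I0 scale_scale.
Qed.
End Orders.

(** * Residues modulo primes *)

Section PrimeField.
Variable p : nat.
Hypothesis p_pr : prime p.
Implicit Types (m n : int) (a b c r : 'F_p).

Lemma Fp_int_eq0 m : (m%:~R == 0 :> 'F_p) = (p%:Z %| m)%Z.
Proof.
rewrite [m]intEsign rmorphM /= rmorphXn /= rmorphN1 mulf_eq0 signr_eq0 /=.
rewrite -[X in X == 0]/(`|m|%N%:R) -(dvdn_pcharf (pchar_Fp p_pr)).
by rewrite dvdzE abszMsign.
Qed.

Lemma Fp_nat a : exists k : nat, a = k%:R.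
Proof. by exists a; rewrite natr_Zp. Qed.

(** A choice [g] of square roots for all elements would be a bijection with squaring as inverse, but
    squaring identifies [1] and [-1]. *)
Lemma Fp_nonsquare : odd p -> exists c, forall r, c != r ^+ 2.
Proof.
move=> p_odd; apply: contrapT => nex.
have sq c : exists r, r ^+ 2 == c.
  apply: contrapT => nr; apply: nex; exists c => r.
  by apply/eqP => E; apply: nr; exists r; rewrite -E.
have [g gK] : exists g : 'F_p -> 'F_p, forall c, g c ^+ 2 = c.
  by exists (fun c => xchoose (sq c)) => c; apply/eqP/(xchooseP (sq c)).
have g_inj : injective g by move=> a b E; rewrite -(gK a) E gK.
have [h _ hK] := injF_bij g_inj.
have : (1 : 'F_p) = -1.
  have h1 : h 1 = 1 by rewrite -(gK (h 1)) hK expr1n.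
  have hN : h (-1) = 1 by rewrite -(gK (h (-1))) hK sqrrN expr1n.
  by rewrite -(hK (-1)) hN -{2}h1 hK.
move/eqP; rewrite -subr_eq0 opprK -(natrD _ 1 1) -(dvdn_pcharf (pchar_Fp p_pr)).
by move/dvdn_leq => /(_ isT); have := prime_gt1 p_pr; case: p p_odd => [|[|[|]]].
Qed.

(** If [-c] is not a square, it is itself a value. If [-c = s^2], the form represents every
    [t^2 + 1], and the least natural number that is a nonsquare modulo [p] has this shape, its
    predecessor being a square. *)
Lemma norm_form_nonsquare c : odd p -> c != 0 ->
  exists a b, forall r, a ^+ 2 - c * b ^+ 2 != r ^+ 2.
Proof.
move=> p_odd c0; have [[s sE]|ns] := pselect (exists s, - c = s ^+ 2); last first.
  exists 0, 1 => r; apply/eqP => E; apply: ns; exists r; rewrite -E; ring.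
have s0 : s != 0.
  by apply/eqP => s0; move/eqP: sE; rewrite s0 expr0n oppr_eq0 (negPf c0).
have [e eN] := Fp_nonsquare p_odd.
pose P (k : nat) := [forall r : 'F_p, k%:R != r ^+ 2].
have exP : exists k, P k.
  by have [k ek] := Fp_nat e; exists k; apply/forallP => r; rewrite -ek.
case: (ex_minnP exP) => -[|k] /forallP Pk mink.
  by have := Pk 0; rewrite expr0n eqxx.
have : ~~ P k by apply/negP => /mink; rewrite ltnn.
case/forallPn => t; rewrite negbK => /eqP kt.
exists t, s^-1 => r; have := Pk r; rewrite -natr1 kt.
suff -> : t ^+ 2 - c * s^-1 ^+ 2 = t ^+ 2 + 1 by [].
by rewrite -mulNr sE -exprMn divff // expr1n.
Qed.

Lemma coprimez_Fp m : coprimez m p = (m%:~R != 0 :> 'F_p).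
Proof. by rewrite Fp_int_eq0 coprimezE coprime_sym prime_coprime // dvdzE. Qed.

End PrimeField.

(** * Powers of a quadratic element over a field *)

Section MultiplicationTable.
Variable F : fieldType.
Variables (T V X Y : F).
Implicit Types (w : F * F).

(** Multiplication by [X + Y omega] in the basis [1, omega], where [omega^2 = T omega + V]. *)
Definition mul_step w : F * F :=
  (w.1 * X + V * w.2 * Y, w.1 * Y + w.2 * X + T * w.2 * Y).

(* When the discriminant [T^2 + 4V] vanishes, [X + Y omega] acts unipotently up
   to the scalar [h]. *)
Lemma iter_mul_step_unipotent w k : T ^+ 2 + 4 * V = 0 -> (2 : F) != 0 ->
    2 * X + T * Y != 0 ->
  (* With [e = omega - T/2] one has [e^2 = 0]; the multiplier is [h + Y e] and [w] is [c/2 + w.2 e],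
     so the formulas expand [(h + Y e)^k]. *)
  let h := (2 * X + T * Y) / 2 in let c := 2 * w.1 + T * w.2 in
  let w' := iter k mul_step w in
  2 * w'.1 + T * w'.2 = c * h ^+ k /\
  w'.2 = h ^+ k * (w.2 + k%:R * (c * Y / (2 * h))).
Proof.
move=> D0 t0 X0 h c; elim: k => [|k [IH1 IH2]].
  by split; rewrite /= ?expr0 ?mulr1 // mul1r mul0r addr0.
rewrite iterS /=; move: IH1 IH2 => /=; set w' := iter k _ _ => IH1 IH2.
have hE : 2 * X + T * Y = 2 * h by rewrite /h; field.
have h0 : h != 0 by apply: contraNneq X0 => h0; rewrite hE h0 mulr0.
have E1 : 2 * (w'.1 * Y + w'.2 * X + T * w'.2 * Y)
    = (2 * w'.1 + T * w'.2) * Y + w'.2 * (2 * X + T * Y) by ring.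
have E2 : 2 * (2 * (w'.1 * X + V * w'.2 * Y) + T * (w'.1 * Y + w'.2 * X + T * w'.2 * Y))
    = (2 * w'.1 + T * w'.2) * (2 * X + T * Y) + (T ^+ 2 + 4 * V) * w'.2 * Y by ring.
split; apply: (mulfI t0).
  by rewrite E2 D0 IH1 hE exprS; ring.
rewrite E1 IH1 hE IH2 exprS -[k.+1]addn1 natrD; field.
by rewrite h0.
Qed.
End MultiplicationTable.


(** * The residue criterion for orders, and the units *)

Section Criterion.
Variable d : nat.
Hypotheses (d2 : (2 <= d)%N) (sfd : squarefree d).
Implicit Types (m n u v : int) (z w g : quad d) (f p k : nat).

Let B := @ringint d.
Let sB : subring B. Proof. exact: subring_ringint. Qed.

(** This is [residues_lift] in coordinates: an element of [B] is invertible modulo [f] exactly when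
    its norm is coprime to [f]. *)
Definition relatively_trivial f : Prop := forall m n, coprimez (nrm d m n) f ->
  exists2 g, unit_of B g & order_cond f (qz d m n * g).

Lemma qz_one : qz d 1 0 = 1. Proof. by rewrite qz_int. Qed.

Lemma qz_sub1 m n : qz d m n - 1 = qz d (m - 1) n.
Proof. by rewrite /qz; ring. Qed.

Lemma ringintP z : B z -> exists m n, z = qz d m n.
Proof. by rewrite /B ringintE. Qed.

Lemma Pic_order_eqP f : (0 < f)%N ->
  Pic B #= Pic (@order_cond d f) <-> relatively_trivial f.
Proof.
move=> f0; have sA := subring_order d2 sfd f.
have AB := @order_sub d d2 sfd f.
apply: (iff_trans (Pic_card_eqP sA sB AB (order_nat d2 sfd f f) (@scale_order d d2 sfd f)
  (fun z => @ringint_regular d d2 sfd f z f0) (fraction_order d2 sfd f0) (finite_Pic d2 sfd))).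
split.
  move=> rl m n /coprimezP[[k l] /= kl].
  (* The inverse modulo [f] is the conjugate [m + tau n - n omega] times the inverse [k] of the
     norm. *)
  apply: (rl _ (qz d (k * (m + tau d * n)) (- k * n))); try exact: (ringint_qz d2).
  rewrite (qzM d2) qz_sub1; apply/(scale_qz d2 sfd _ _ f0).
  split; last by apply/dvdzP; exists 0; ring.
  by apply/dvdzP; exists (- l); rewrite -kl /nrm; ring.
move=> rt a b /ringintP[m [n ->]] /ringintP[p [q ->]] mab.
apply: rt; apply/coprimezP; move: mab.
rewrite (qzM d2) qz_sub1 => /(scale_qz d2 sfd _ _ f0)[/dvdzP[r rE] /dvdzP[t tE]].
(* The product is [(1 + r f) + t f omega]; the second coefficient is read off its norm, which is [1]
   modulo [f]. *)
exists (nrm d p q, - (2 * r + r * r * f%:Z + tau d * t * (1 + r * f%:Z) - nu d * t * t * f%:Z)).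
rewrite /= mulrC nrmM.
have -> : m * p + nu d * n * q = 1 + r * f%:Z by rewrite -rE; ring.
have -> : m * q + n * p + tau d * n * q = t * f%:Z by rewrite -tE; ring.
by rewrite /nrm; ring.
Qed.

Lemma coprimez_congr m n k : (k%:Z %| m - n)%Z -> coprimez n k -> coprimez m k.
Proof.
move=> /dvdzP[q E] /coprimezP[[u v] /= uv]; apply/coprimezP.
have -> : m = n + q * k%:Z by rewrite -E; ring.
by exists (u, v - u * q); rewrite /= -uv; ring.
Qed.

Lemma order_dvd f p z : (p %| f)%N -> order_cond f z -> order_cond p z.
Proof.
move=> /dvdnP[k ->]; rewrite !(orderE d2 sfd) => -[m [n ->]].
by exists m, (k%:Z * n); congr qz; rewrite PoszM; ring.
Qed.

Lemma nrm_congr (k m n u v : int) :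
  (k %| nrm d (m + k * u) (n + k * v) - nrm d m n)%Z.
Proof.
apply/dvdzP; exists (2 * m * u + tau d * (m * v + n * u) - 2 * nu d * n * v
  + k * (u * u + tau d * u * v - nu d * v * v)).
by rewrite /nrm; ring.
Qed.

(* The residue of [m + n omega] modulo [p] lifts to a residue modulo [f] that is [1] modulo
   the prime-to-[p] part of [f]. *)
Lemma relatively_trivial_prime f p : (0 < f)%N -> prime p -> (p %| f)%N ->
  relatively_trivial f -> relatively_trivial p.
Proof.
move=> f0 p_pr pf rt m n cNp; have sP := subring_order d2 sfd p.
pose M := chinese p f`_p^' 1 0.
have cpf : coprime p f`_p^' by apply: (@pnat_coprime p); rewrite ?pnat_id ?part_pnat.
have M1 : (p%:Z %| M%:Z - 1)%Z.
  have := chinese_modl cpf 1 0; rewrite -/M => E.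
  by rewrite -eqz_mod_dvd (modz_nat M p) (modz_nat 1 p) E.
have M0 : (f`_p^' %| M)%N.
  by have := chinese_modr cpf 1 0; rewrite -/M mod0n /dvdn => ->.
pose m' := 1 + M%:Z * (m - 1); pose n' := M%:Z * n.
have cN : coprimez (nrm d m' n') f.
  rewrite -(partnC p f0) PoszM coprimezMr; apply/andP; split.
    rewrite coprimezE /= p_part coprimeXr // -[p]absz_nat -coprimezE.
    apply: coprimez_congr cNp; case/dvdzP: M1 => q qE.
    have -> : m' = m + q * p%:Z * (m - 1) by rewrite -qE /m'; ring.
    have -> : n' = n + q * p%:Z * n by rewrite -qE /n'; ring.
    by rewrite (dvdz_trans _ (nrm_congr _ _ _ _ _)) // dvdz_mull.
  apply: (@coprimez_congr _ 1); last by rewrite coprimezE coprime1n.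
  have <- : nrm d 1 0 = 1 by rewrite /nrm; ring.
  rewrite /m' /n' -[M%:Z * n]add0r (dvdz_trans _ (nrm_congr _ _ _ _ _)) //.
have [g ug Og] := rt m' n' cN; exists g => //.
have Bg : B g by case: ug.
have -> : qz d m n * g = qz d m' n' * g - (M%:Z - 1)%:~R * (qz d (m - 1) n * g).
  by rewrite /m' /n' /qz; ring.
apply: (subringB sP); first exact: order_dvd Og.
case/dvdzP: M1 => q ->; apply: (scale_order d2 sfd).
exists (q%:~R * (qz d (m - 1) n * g)); last by rewrite intrM; ring.
by apply: (subringM sB); [rewrite -qz_int|apply: (subringM sB)] => //; apply: (ringint_qz d2).
Qed.

Lemma unit_norm u v : unit_of B (qz d u v) -> nrm d u v = 1 \/ nrm d u v = -1.
Proof.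
move=> [u0 _ /ringintP[p [q E]]].
have N1 : nrm d u v * nrm d p q = 1.
  apply: (@intr_inj rat); rewrite intrM -!(quad_norm_qz d2 sfd) -quad_normM // -E.
  by rewrite divff // quad_norm1.
by move/(congr1 absz): N1 => /eqP; rewrite abszM muln_eq1 => /andP[/eqP]; lia.
Qed.

Lemma unit_conj u v : (qz d u v != 0) -> nrm d u v = 1 \/ nrm d u v = -1 ->
  (qz d u v)^-1 = (nrm d u v)%:~R * qz d (u + tau d * v) (- v).
Proof.
move=> u0 N1; apply: (mulfI u0); rewrite divff // qz_scale (qzM d2) -qz_one.
congr qz; last by ring.
transitivity (nrm d u v * nrm d u v); first by case: N1 => ->.
by rewrite {2}/nrm; ring.
Qed.

(** Up to sign the inverse of a unit is its conjugate, whose coefficient of [omega] is the opposite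
    one. *)
Lemma order_unitV f g : unit_of B g -> order_cond f g -> order_cond f g^-1.
Proof.
move=> ug; have [g0 Bg _] := ug; have [u [v E]] := ringintP Bg; rewrite E in ug g0 *.
rewrite unit_conj //; last exact: unit_norm.
rewrite qz_scale !(order_qz d2 sfd) => fv; apply: dvdz_mull.
by case/dvdzP: fv => q ->; apply/dvdzP; exists (- q); ring.
Qed.

Section FundamentalUnit.
Variables (eps : quad d) (x y : nat).
Hypotheses (eps_fund : fundamental_unit eps) (eps_xy : eps = x%:R + y%:R * omega d).

Lemma eps_qz : eps = qz d x y. Proof. exact: eps_xy. Qed.

Lemma unitsE : unit_of B = [set u | exists k : int, u = eps ^ k \/ u = - eps ^ k].
Proof. by case: eps_fund. Qed.

Lemma unit_eps k : unit_of B (eps ^+ k).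
Proof. by rewrite unitsE; exists k%:Z; left. Qed.

Lemma nrm_eps : nrm d x y = 1 \/ nrm d x y = -1.
Proof. by apply: unit_norm; rewrite -eps_qz -[eps]expr1; apply: unit_eps. Qed.

Lemma unit_in_order f : (f %| y)%N -> forall g, unit_of B g -> order_cond f g.
Proof.
move=> fy g ug; have sf := subring_order d2 sfd f.
have Oe : order_cond f eps by rewrite eps_qz order_qz.
have Oek (k : int) : order_cond f (eps ^ k).
  case: k => k; first exact: subringX.
  by apply: order_unitV; [apply: unit_eps|apply: subringX].
move: ug; rewrite unitsE => -[k [->|->]]; first exact: Oek.
exact: subringN.
Qed.

Lemma unit_norm1 : nrm d x y = 1 -> forall u v, unit_of B (qz d u v) -> nrm d u v = 1.
Proof.
move=> N1 u v; rewrite unitsE => -[k uE].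
have Ne : quad_norm eps = 1 by rewrite eps_qz quad_norm_qz // N1.
have Nek (l : nat) : quad_norm (eps ^+ l) = 1.
  by elim: l => [|l IHl]; rewrite ?expr0 ?quad_norm1 // exprS quad_normM // Ne IHl mulr1.
have Nk : quad_norm (eps ^ k) = 1.
  case: k uE => l _; first exact: Nek.
  have e0 : eps ^+ l.+1 != 0 by case: (unit_eps l.+1).
  by rewrite -[LHS]mulr1 -(Nek l.+1) -quad_normM // mulVf // quad_norm1.
apply: (@intr_inj rat); rewrite -(quad_norm_qz d2 sfd).
case: uE => -> //; rewrite -mulN1r quad_normM // Nk mulr1.
have -> : -1 = qz d (-1) 0 by rewrite /qz; ring.
by rewrite quad_norm_qz // /nrm; congr (_%:~R); ring.
Qed.

Section Residues.
Variable p : nat.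
Hypothesis p_pr : prime p.
Local Notation "m %:p" := (m%:~R : 'F_p) (at level 2, left associativity, format "m %:p").

Lemma nrm_Fp m n : (nrm d m n)%:p
  = m%:p ^+ 2 + (tau d)%:p * m%:p * n%:p - (nu d)%:p * n%:p ^+ 2.
Proof. by rewrite /nrm !(intrD, intrM, rmorphN) /=; ring. Qed.

Lemma order_Fp m n : order_cond p (qz d m n) <-> n%:p = 0.
Proof.
by rewrite (order_qz d2 sfd) -Fp_int_eq0 //; split=> /eqP.
Qed.

Lemma qz_eps_pow m n k : exists a b, qz d m n * eps ^+ k = qz d a b /\
  (a%:p, b%:p) = iter k (mul_step (tau d)%:p (nu d)%:p x%:p y%:p) (m%:p, n%:p).
Proof.
elim: k => [|k [a [b [IH1 IH2]]]]; first by exists m, n; rewrite expr0 mulr1.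
rewrite iterS -IH2 exprSr mulrA IH1 eps_qz (qzM d2); eexists; eexists; split=> //.
by rewrite /mul_step /= !(intrD, intrM).
Qed.

(** The positive cases become computations over [F_p]: some power of [eps] has to clear the
    coordinate along [omega]. *)
Lemma trivial_pow : (forall m n, (nrm d m n)%:p != 0 -> exists k,
    (iter k (mul_step (tau d)%:p (nu d)%:p x%:p y%:p) (m%:p, n%:p)).2 = 0) ->
  relatively_trivial p.
Proof.
move=> pow m n; rewrite coprimez_Fp // => /pow[k bk0].
exists (eps ^+ k); first exact: unit_eps.
have [a [b [-> E]]] := qz_eps_pow m n k; apply/order_Fp.
by rewrite -bk0 -E.
Qed.

Lemma not_trivial_dvd m n : (p %| y)%N -> (nrm d m n)%:p != 0 -> n%:p != 0 ->
  ~ relatively_trivial p.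
Proof.
move=> py N0 n0; move/(_ m n); rewrite coprimez_Fp // => /(_ N0)[g ug].
have [_ Bg _] := ug; have := unit_in_order py ug.
have [u [v E]] := ringintP Bg; rewrite E in ug *; rewrite (qzM d2) => /order_Fp v0.
move/order_Fp; rewrite !(intrD, intrM) v0 !mulr0 add0r addr0 => /eqP.
rewrite mulf_eq0 (negPf n0) /= => /eqP u0.
have : (nrm d u v)%:p = 0 by rewrite nrm_Fp u0 v0; ring.
by case: (unit_norm ug) => -> /eqP; rewrite ?rmorphN1 ?oppr_eq0 oner_eq0.
Qed.

Lemma not_trivial_norm1 : odd p -> ~~ (p %| d)%N -> nrm d x y = 1 -> ~ relatively_trivial p.
Proof.
move=> p_odd pd N1.
have d0 : d%:R != 0 :> 'F_p by rewrite -(dvdn_pcharf (pchar_Fp p_pr)).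
have [a [b ab]] := norm_form_nonsquare p_pr p_odd d0.
have [k ak] := Fp_nat a; have [l bl] := Fp_nat b.
(* These are the coordinates of [k + l sqrt d]; when [omega = (1 + sqrt d) / 2] it equals
   [(k - l) + 2 l omega]. *)
have [m [n Nmn]] : exists m n, nrm d m n = k%:Z ^+ 2 - d%:Z * l%:Z ^+ 2.
  rewrite /nrm; case d1: (d %% 4 == 1)%N.
    have [-> dE] := tau_nu1 d2 d1; exists (k%:Z - l%:Z), (2 * l%:Z).
    by rewrite [d%:Z]dE; ring.
  by have [-> ->] := tau_nu2 d1; exists k%:Z, l%:Z; ring.
have NE : (nrm d m n)%:p = a ^+ 2 - d%:R * b ^+ 2.
  by rewrite Nmn intrB intrM !rmorphXn /= ak bl.
move/(_ m n); rewrite coprimez_Fp // NE.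
have -> : a ^+ 2 - d%:R * b ^+ 2 != 0 by have := ab 0; rewrite expr0n.
case=> // g ug; have [_ Bg _] := ug.
have [u [v E]] := ringintP Bg; rewrite E in ug *; rewrite (qzM d2).
set r := m * u + _; set t := _ + _ => /order_Fp t0.
have /eqP := ab r%:p; apply; rewrite -NE.
have -> : nrm d m n = nrm d r t by rewrite -[LHS]mulr1 -(unit_norm1 N1 ug) nrmM.
by rewrite nrm_Fp t0; ring.
Qed.
End Residues.
End FundamentalUnit.
End Criterion.

Lemma F3_mem (a : 'F_3) : a \in [:: 0; 1; 2].
Proof. by case: a => [[|[|[|//]]] i]. Qed.

Lemma F2_mem (a : 'F_2) : a \in [:: 0; 1].
Proof. by case: a => [[|[|//]] i]. Qed.

(** Norm [-1] excludes a ramified 3, where norms are squares. Modulo [F_3] scalars the invertible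
    residues form a cyclic group of order 4 (inert) or 2 (split), generated by an element of norm
    [-1]; hence exponents up to 3. *)
Lemma norm_m1_mod3 (t v x y a b : 'F_3) : x ^+ 2 + t * x * y - v * y ^+ 2 = -1 ->
  a ^+ 2 + t * a * b - v * b ^+ 2 != 0 ->
  exists k, (iter k (mul_step t v x y) (a, b)).2 = 0.
Proof.
move=> /eqP N1 N0.
pose s : seq 'F_3 := [:: 0; 1; 2].
pose chk (t v x y a b : 'F_3) := (x ^+ 2 + t * x * y - v * y ^+ 2 == -1) ==>
  (a ^+ 2 + t * a * b - v * b ^+ 2 != 0) ==>
  has (fun k => (iter k (mul_step t v x y) (a, b)).2 == 0) [:: 0; 1; 2; 3]%N.
have : all (fun t => all (fun v => all (fun x => all (fun y => all (fun a =>
   all (chk t v x y a) s) s) s) s) s) s by vm_compute.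
move=> /allP/(_ t (F3_mem t))/allP/(_ v (F3_mem v))/allP/(_ x (F3_mem x)).
move=> /allP/(_ y (F3_mem y))/allP/(_ a (F3_mem a))/allP/(_ b (F3_mem b)).
by rewrite /chk N1 N0 !implyTb => /hasP[k _ /eqP k0]; exists k.
Qed.

(** The invertible residues form a group of order 3 (inert), 2 (ramified) or 1 (split, the case
    [t = 1], [v = 0]). An invertible residue with [y = 1] generates it, so exponents up to 2
    suffice. *)
Lemma norm_neq0_mod2 (t v x y a b : 'F_2) : (y == 1) || (t == 1) && (v == 0) ->
  x ^+ 2 + t * x * y - v * y ^+ 2 != 0 -> a ^+ 2 + t * a * b - v * b ^+ 2 != 0 ->
  exists k, (iter k (mul_step t v x y) (a, b)).2 = 0.
Proof.
move=> tvy N1 N0.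
pose s : seq 'F_2 := [:: 0; 1].
pose chk (t v x y a b : 'F_2) := ((y == 1) || (t == 1) && (v == 0)) ==>
  (x ^+ 2 + t * x * y - v * y ^+ 2 != 0) ==> (a ^+ 2 + t * a * b - v * b ^+ 2 != 0) ==>
  has (fun k => (iter k (mul_step t v x y) (a, b)).2 == 0) [:: 0; 1; 2]%N.
have : all (fun t => all (fun v => all (fun x => all (fun y => all (fun a =>
   all (chk t v x y a) s) s) s) s) s) s by vm_compute.
move=> /allP/(_ t (F2_mem t))/allP/(_ v (F2_mem v))/allP/(_ x (F2_mem x)).
move=> /allP/(_ y (F2_mem y))/allP/(_ a (F2_mem a))/allP/(_ b (F2_mem b)).
by rewrite /chk tvy N1 N0 !implyTb => /hasP[k _ /eqP k0]; exists k.
Qed.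

(** * Which conductors satisfy the criterion *)

Section Cases.
Variable d : nat.
Hypotheses (d2 : (2 <= d)%N) (sfd : squarefree d).
Variables (eps : quad d) (x y : nat).
Hypotheses (eps_fund : fundamental_unit eps) (eps_xy : eps = x%:R + y%:R * omega d).

Let eps1 := nrm_eps d2 sfd eps_fund eps_xy.

Lemma nrm_eps_Fp p : prime p -> (nrm d x y)%:~R != 0 :> 'F_p.
Proof. by case: eps1 => -> _; rewrite ?rmorphN1 ?oppr_eq0 oner_eq0. Qed.

Lemma discriminant : exists2 k : int, tau d * tau d + 4 * nu d = k * d & k = 1 \/ k = 4.
Proof.
case d1: (d %% 4 == 1)%N.
  by have [-> dE] := tau_nu1 d2 d1; exists 1; [rewrite dE; ring|left].
by have [-> ->] := tau_nu2 d1; exists 4; [ring|right].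
Qed.

Lemma Fp_two_neq0 p : prime p -> odd p -> 2 != 0 :> 'F_p.
Proof.
move=> p_pr p_odd; rewrite -(dvdn_pcharf (pchar_Fp p_pr)) gtnNdvd //.
by rewrite odd_prime_gt2.
Qed.

Lemma trivial_three : nrm d x y = -1 -> relatively_trivial d 3.
Proof.
move=> N1; apply: (trivial_pow d2 sfd eps_fund eps_xy) => // m n.
rewrite nrm_Fp => N0; apply: norm_m1_mod3 => //.
by rewrite -nrm_Fp N1 rmorphN1.
Qed.

Lemma trivial_two : (d %% 8 = 1)%N \/ odd y -> relatively_trivial d 2.
Proof.
move=> yd; apply: (trivial_pow d2 sfd eps_fund eps_xy) => // m n.
rewrite nrm_Fp => N0; apply: norm_neq0_mod2 => //; last first.
  by rewrite -nrm_Fp nrm_eps_Fp.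
case: yd => [d8|y_odd]; apply/orP; [right|left]; last first.
  have := F2_mem (y%:Z)%:~R; rewrite !inE Fp_int_eq0 // dvdzE dvdn2 /= y_odd.
  by case/orP.
have d1 : (d %% 4 == 1)%N by lia.
have [-> dE] := tau_nu1 d2 d1; rewrite eqxx /= Fp_int_eq0 //.
by apply/dvdzP; exists (d %/ 8)%N%:Z; lia.
Qed.

(** Up to a nonzero scalar, the [omega]-coordinate of [z * eps ^+ k] is affine in [k], with nonzero
    slope because [p] does not divide [y]; so it vanishes for some [k]. *)
Lemma trivial_ramified p : prime p -> odd p -> (p %| d)%N -> ~~ (p %| y)%N ->
  relatively_trivial d p.
Proof.
move=> p_pr p_odd pd py; apply: (trivial_pow d2 sfd eps_fund eps_xy) => // m n.
rewrite nrm_Fp; have := nrm_eps_Fp p_pr; rewrite nrm_Fp.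
have t0 := Fp_two_neq0 p_pr p_odd.
have y0 : (y%:Z)%:~R != 0 :> 'F_p by rewrite Fp_int_eq0 // dvdzE.
have [k kE _] := discriminant.
have D0 : (tau d)%:~R ^+ 2 + 4 * (nu d)%:~R = 0 :> 'F_p.
  transitivity ((tau d * tau d + 4 * nu d)%:~R : 'F_p); first by rewrite intrD !intrM; ring.
  by apply/eqP; rewrite kE Fp_int_eq0 // dvdz_mull // dvdzE.
move: D0 y0; set T := (tau d)%:~R; set V := (nu d)%:~R; move: (x%:Z%:~R) (y%:Z%:~R) m%:~R n%:~R.
move: T V => T V X Y M N D0 Y0 NX NM.
(* With discriminant zero, four times the norm is the square of [2 a + T b]. *)
have lin0 a b : a ^+ 2 + T * a * b - V * b ^+ 2 != 0 -> 2 * a + T * b != 0.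
  apply: contraNneq => E.
  have : (2 * 2) * (a ^+ 2 + T * a * b - V * b ^+ 2) = 0.
    transitivity ((2 * a + T * b) ^+ 2 - (T ^+ 2 + 4 * V) * b ^+ 2); first by ring.
    by rewrite D0 E; ring.
  by move/eqP; rewrite !mulf_eq0 (negPf t0) /= => ->.
have X0 := lin0 _ _ NX; have M0 := lin0 _ _ NM.
(* The zero of the affine function of [k] in [iter_mul_step_unipotent], where [2 h = 2 X + T Y]. *)
have [l lE] := Fp_nat (- N * (2 * X + T * Y) / ((2 * M + T * N) * Y)).
exists l; have [_ ->] := @iter_mul_step_unipotent _ T V X Y (M, N) l D0 t0 X0.
apply/eqP; rewrite mulf_eq0; apply/orP; right; rewrite /= -lE; apply/eqP; field.
by rewrite M0 X0 Y0 t0.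
Qed.

Lemma not_trivial f : nrm d x y = 1 -> (d %% 8)%N <> 1%N -> ~~ odd y -> (d %| y)%N ->
  (1 < f)%N -> ~ relatively_trivial d f.
Proof.
move=> N1 d8 y_even dy f1 /(relatively_trivial_prime d2 sfd (ltnW f1) (pdiv_prime f1) (pdiv_dvd f)).
have p_pr := pdiv_prime f1; move: (pdiv f) p_pr => {f f1} p p_pr.
have [k kE k14] := discriminant.
have ND := not_trivial_dvd d2 sfd eps_fund eps_xy p_pr.
have [p2|p_odd] := even_prime p_pr.
  rewrite p2 in p_pr ND *; have y2 : (2 %| y)%N by rewrite dvdn2.
  have one0 : (1 : int)%:~R != 0 :> 'F_2 by rewrite oner_neq0.
  (* An odd norm with [n = 1] exists because 2 does not split: for [tau = 1], [nu] is odd and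
     [m = 0] works; otherwise [m] has parity opposite to [d]. *)
  have [m N0] : exists m, (nrm d m 1)%:~R != 0 :> 'F_2; last exact: ND N0 one0.
  case d1: (d %% 4 == 1)%N.
    exists 0; have [tE dE] := tau_nu1 d2 d1; rewrite /nrm Fp_int_eq0 // tE; lia.
  have [tE nE] := tau_nu2 d1; rewrite /nrm tE nE.
  by case do: (odd d); [exists 0|exists 1]; rewrite Fp_int_eq0 //; lia.
have [pd|pd] := boolP (p %| d)%N; last exact: (not_trivial_norm1 d2 sfd eps_fund eps_xy p_pr p_odd pd N1).
have t0 := Fp_two_neq0 p_pr p_odd.
(* The element is [1 + sqrt d], of norm [1] modulo [p]; it equals [2 omega] when [d] is 1 modulo
   4. *)
have [m [n [n0 N0]]] : exists m n, [/\ n = 1 \/ n = 2 & nrm d m n = 1 - d%:Z].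
  rewrite /nrm; case d1: (d %% 4 == 1)%N.
    have [-> dE] := tau_nu1 d2 d1; exists 0, 2; split; [by right|].
    by rewrite dE; ring.
  by have [-> ->] := tau_nu2 d1; exists 1, 1; split; [left|ring].
apply: (ND m n).
- exact: dvdn_trans pd dy.
- rewrite N0 intrB (_ : (d%:Z)%:~R = 0) ?subr0 ?oner_neq0 //.
  by apply/eqP; rewrite Fp_int_eq0 // dvdzE.
- by case: n0 => ->; rewrite ?oner_neq0.
Qed.
End Cases.

Theorem proposition2p2 (d : nat) (eps : quad d) (x y : nat)
    (d_ge2 : (2 <= d)%N) (d_sqf : squarefree d)
    (eps_fund : fundamental_unit eps)
    (eps_xy : eps = x%:R + y%:R * omega d) :
  [set f : nat | (0 < f)%N /\ Pic (@ringint d) #= Pic (@order_cond d f)]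
    = [set 1%N]
  <-> [/\ quad_norm eps = 1, (d %% 8)%N <> 1%N, ~~ odd y & (d %| y)%N].
Proof.
have PicP := Pic_order_eqP d_ge2 d_sqf.
have NE : quad_norm eps = (nrm d x y)%:~R.
  by rewrite (eps_qz eps_xy) quad_norm_qz.
split=> [E|[N1 d8 y_even dy]]; last first.
  apply/seteqP; split=> [f [f0 /(PicP f f0) rt]|_ ->]; last first.
    by split=> //; rewrite (order1 d_ge2 d_sqf); exact: card_eqxx.
  case: (ltnP 1 f) => f1; last by apply/eqP; rewrite eqn_leq f1.
  case: (not_trivial d_ge2 d_sqf eps_fund eps_xy _ d8 y_even dy f1 rt).
  by apply: (@intr_inj rat); rewrite -NE N1.
have nrt f : (1 < f)%N -> ~ relatively_trivial d f.
  move=> f1 rt; have : [set 1%N] f by rewrite -E; split; [exact: ltnW|apply/PicP => //; exact: ltnW].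
  by move=> f1E; rewrite f1E in f1.
have d8 : (d %% 8)%N <> 1%N.
  by move=> d8; apply: (nrt 2) => //; apply: (trivial_two d_ge2 d_sqf eps_fund eps_xy); left.
have y_even : ~~ odd y.
  by apply/negP => oy; apply: (nrt 2) => //; apply: (trivial_two d_ge2 d_sqf eps_fund eps_xy); right.
split=> //.
  rewrite NE; have [-> //|N1] := nrm_eps d_ge2 d_sqf eps_fund eps_xy.
  by case: (nrt 3) => //; apply: (trivial_three d_ge2 d_sqf eps_fund eps_xy).
have d0 : (0 < d)%N by lia.
case: (posnP y) => [->|y0]; first exact: dvdn0.
apply/(dvdn_partP y d0) => p; rewrite mem_primes => /and3P[p_pr _ pd].
(* As [d] is squarefree, divisibility of [y] by [d] can be tested one prime at a time. *)
have -> : (d`_p)%N = p.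
  rewrite p_part (_ : logn p d = 1%N) // ; apply/eqP; rewrite eqn_leq.
  rewrite logn_gt0 mem_primes p_pr d0 pd !andbT leqNgt; apply/negP => l2.
  have p2d : (p ^ 2 %| d)%N by rewrite pfactor_dvdn.
  by rewrite (d_sqf p p2d) in p_pr.
have [p2|p_odd] := even_prime p_pr; first by rewrite p2 dvdn2.
apply: contrapT => /negP py; case: (nrt p); first exact: prime_gt1.
exact: (trivial_ramified d_ge2 d_sqf eps_fund eps_xy).
Qed.
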